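(* Let $a=(a_0,a_1)$ and $b=(b_0,b_1)$ be vectors in $\mathbb{R}^2$, neither of which is null (i.e. $|a_0|\neq|a_1|$ and $|b_0|\neq|b_1|$). Let $\theta^+$ on $(0,\pi)$ and $\theta^-$ on $(-\pi,0)$ be the complex dihedral angles between $a$ and $b$ as functions of the Wick rotation angle $\phi$, and let $N_c$ be the number of light rays in the convex wedge spanned by $a$ and $b$. Then the analytic continuations of $\theta^+$ and $\theta^-$ in $\phi$ lead to periodic functions on $(-2\pi,2\pi]$ (period $4\pi$), given by $$\theta^\pm(\phi)=\begin{cases}-\imath\log_\mp\left(\dfrac{a\star b\mp2\imath\,e^{\imath\phi/2}|A(a,b)|}{\sqrt{a\star a}\,\sqrt{b\star b}}\right) & \text{for }\phi\in(-\pi,\pi],\\[3mm] -\imath\log_\pm\left(\dfrac{a\star b\mp2\imath\,e^{\imath\phi/2}|A(a,b)|}{\sqrt{a\star a}\,\sqrt{b\star b}}\right)\mp N_c\,\pi & \text{for }\phi\in(-2\pi,-\pi]\cup(\pi,2\pi].\end{cases}$$ For these analytic continuations the following hold. 1. $\theta^+=-\theta^-$. 2. The real parts of $\theta^\pm$ are even functions of $\phi$ and the imaginary parts are odd functions of $\phi$; hence the imaginary parts vanish for $\phi=0$ and $\phi=2\pi$. 3. $\mathrm{Re}(\theta^+(\pm\pi))=-\pi N_c/2$ and $\mathrm{Re}(\theta^-(\pm\pi))=+\pi N_c/2$. 4. (Euclidean data) $\theta^\pm(0)=\mp\psi_E$ and $\theta^\pm(2\pi)=\pm\psi_E\mp\pi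 N_c$. 5. (Lorentzian data) $\theta^\pm(+\pi)=\mp\imath\,\psi_{L+}$ and $\theta^\pm(-\pi)=\pm\imath\,\psi_{L-}$. Here $\psi_E$ is the Euclidean angle and $\psi_{L\pm}$ are the two versions of the Lorentzian angle between $a$ and $b$. In formulas with $\pm$ and $\mp$ on both sides, upper signs go with $\theta^+$ and lower signs with $\theta^-$ (except that in item 3 $\pm\pi$ denotes both evaluation points).
   Context: Notation. $\imath$ is the imaginary unit. For $x,y\in\mathbb{R}^2$ with components $(x_0,x_1),(y_0,y_1)$ and a Wick rotation angle $\phi$, $x\star y=e^{\imath\phi}x_0y_0+x_1y_1$; $\phi=0$ gives the Euclidean inner product and $\phi=\pm\pi$ the Minkowskian inner product $x\cdot y=-x_0y_0+x_1y_1$. A vector $x$ is space-like, time-like or null if $x\cdot x$ is positive, negative or zero. $|A(a,b)|=\tfrac12|a_0b_1-a_1b_0|$ is the (positive) area of the triangle spanned by $a$ and $b$. Complex dihedral angles: $\theta^+$ on $\phi\in(0,\pi)$ and $\theta^-$ on $\phi\in(-\pi,0)$ are defined as the value of $$\theta(\phi)=-\imath\log\frac{a\star b+\sqrt{(a\star b)^2-(a\star a)(b\star b)}}{\sqrt{a\star a}\,\sqrt{b\star b}}$$ with principal branches for the square roots and the logarithm, except that if $a$ and $b$ are antiparallel one sets $\theta^\pm=\mp\pi$. ''Analytic continuation in $\phi$'' means continuation as an analytic function of the real variable $\phi$. Branches: $\sqrt{\cdot}$ is the principal square root, $\sqrt{re^{\imath\alpha}}=\sqrt r\,e^{\imath\alpha/2}$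 for $\alpha\in(-\pi,\pi]$. The functions $\log_\pm$ agree with the principal logarithm off the negative real axis and are defined for $r>0$ by $\log_+(re^{\imath\alpha})=\log r+\imath\alpha$ for $\alpha\in(-\pi,\pi]$ and $\log_-(re^{\imath\alpha})=\log r+\imath\alpha$ for $\alpha\in[-\pi,\pi)$. Light rays: the four half-lines from the origin consisting of null vectors, i.e. with $x_0=\pm x_1$. Thus $N_c\in\{0,1,2\}$; it is $0$, $1$ or $2$ according to whether $a,b$ lie in the same, neighbouring or opposite quadrants (for antiparallel vectors $N_c=2$), where the quadrants of the Minkowski plane are I $=\{x_1>|x_0|\}$, II $=\{x_0>|x_1|\}$, III $=\{x_1<-|x_0|\}$, IV $=\{x_0<-|x_1|\}$. Euclidean angle: $\psi_E\in[0,\pi]$ is the usual unoriented Euclidean angle between $a$ and $b$. Lorentzian angles: with $\hat x=x/\sqrt{|x\cdot x|}$, the Minkowskian product, $\cosh^{-1}(u)\ge 0$ for $u\geq1$, the angles $\psi_{L\pm}$ (unoriented, symmetric in $a,b$) are - $\psi_{L\pm}=\cosh^{-1}(\hat a\cdot\hat b)$ if $a,b$ are both in quadrant I (or both in III); - $\psi_{L\pm}=\sinh^{-1}(\hat a\cdot\hat b)\mp\tfrac{\pi}{2}\imath$ if $a,b$ are in neighbouring quadrants (one space-like, one time-like); - $\psi_{L\pm}=-\cosh^{-1}(-\hat a\cdot\hat b)\mp\pi\imath$ if one is in quadrant I and the other in III; - $\psi_{L\pm}=-\cosh^{-1}(-\hat a\cdot\hat b)$ if $a,b$ are both in quadrant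 II (or both in IV); - $\psi_{L\pm}=\cosh^{-1}(\hat a\cdot\hat b)\mp\pi\imath$ if one is in quadrant II and the other in IV. *)

(* Defs.v *)
From Stdlib Require Export Reals List.
From Stdlib Require Import Lra Psatz ClassicalEpsilon.
From Coquelicot Require Export Coquelicot.
Open Scope R_scope.

(** Stdlib reals, with Coquelicot's complex numbers and power series. *)

(** ** Signs *)

(** The choice of the upper or the lower sign in a formula with plus-minus
    signs. *)
Inductive pm : Set := Upper | Lower.

Definition pmR (s : pm) : R := match s with Upper => 1 | Lower => -1 end.

Definition flip (s : pm) : pm :=
  match s with Upper => Lower | Lower => Upper end.

(** ** Complex exponential, argument, logarithm, square root *)

Definition cis (t : R) : C := (cos t, sin t).

(** [arg Upper] takes values in (-PI, PI] and [arg Lower] in [-PI, PI); they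
    differ on the negative real axis only. *)
Definition arg (s : pm) (z : C) : R :=
  let t := acos (Re z / Cmod z) in
  match s with
  | Upper => if Rle_dec 0 (Im z) then t else - t
  | Lower => if Rlt_dec 0 (Im z) then t else - t
  end.

(** log_+ is [clog Upper] and log_- is [clog Lower]. *)
Definition clog (s : pm) (z : C) : C := (ln (Cmod z), arg s z).

(** On the negative real axis, too, the principal logarithm is log_+. *)
Definition Clog : C -> C := clog Upper.

Definition Csqrt (z : C) : C := (sqrt (Cmod z) * cis (arg Upper z / 2))%C.

Lemma Cmod_polar (z : C) : z <> 0%C ->
  -1 <= Re z / Cmod z <= 1 /\
  (Re z / Cmod z) ^ 2 + (Im z / Cmod z) ^ 2 = 1.
Proof.
intros Hz.
assert (Hm : 0 < Cmod z) by (apply Cmod_gt_0; exact Hz).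
assert (H1 : (Re z / Cmod z) ^ 2 + (Im z / Cmod z) ^ 2 = 1).
{ replace ((Re z / Cmod z) ^ 2 + (Im z / Cmod z) ^ 2)
    with ((Re z ^ 2 + Im z ^ 2) / Cmod z ^ 2) by (field; lra).
  rewrite <- Cmod2_alt. field; lra. }
split; [nra | exact H1].
Qed.

Lemma clog_polar (s : pm) (z : C) : z <> 0%C -> z = (Cmod z * cis (arg s z))%C.
Proof.
intros Hz.
assert (Hm : 0 < Cmod z) by (apply Cmod_gt_0; exact Hz).
destruct (Cmod_polar z Hz) as [Hb H1].
set (u := Re z / Cmod z) in *; set (v := Im z / Cmod z) in *.
assert (Hc : cos (acos u) = u) by (apply cos_acos; exact Hb).
assert (Hs : sin (acos u) = Rabs v).
{ rewrite (sin_acos u Hb), <- sqrt_Rsqr_abs.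
  f_equal; unfold Rsqr; nra. }
assert (Hcos : cos (arg s z) = u).
{ unfold arg; fold u; destruct s;
  [destruct (Rle_dec 0 (Im z)) | destruct (Rlt_dec 0 (Im z))];
  rewrite ?cos_neg; exact Hc. }
assert (Hi : 0 < / Cmod z) by (apply Rinv_0_lt_compat; exact Hm).
assert (Hsin : sin (arg s z) = v).
{ unfold arg; fold u; destruct s;
  [destruct (Rle_dec 0 (Im z)) as [h|h] | destruct (Rlt_dec 0 (Im z)) as [h|h]];
  rewrite ?sin_neg, Hs;
  [rewrite Rabs_pos_eq | rewrite Rabs_left1
  |rewrite Rabs_pos_eq | rewrite Rabs_left1]; try lra;
  unfold v, Rdiv; nra. }
rewrite (surjective_pairing z) at 1; unfold cis; rewrite Hcos, Hsin.
unfold Cmult, RtoC, u, v, Re, Im; cbn [fst snd].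
f_equal; field; lra.
Qed.

Lemma arg_range (s : pm) (z : C) : z <> 0%C ->
  match s with
  | Upper => - PI < arg s z <= PI
  | Lower => - PI <= arg s z < PI
  end.
Proof.
intros Hz.
assert (Hm : 0 < Cmod z) by (apply Cmod_gt_0; exact Hz).
destruct (Cmod_polar z Hz) as [Hb H1].
pose proof (acos_bound (Re z / Cmod z)) as Ha.
pose proof PI_RGT_0 as Hpi.
assert (Hi : 0 < / Cmod z) by (apply Rinv_0_lt_compat; exact Hm).
assert (Hlt : Im z <> 0 -> acos (Re z / Cmod z) < PI).
{ intros Hy. destruct (Rle_lt_or_eq_dec _ _ (proj2 Ha)) as [h|h]; [exact h|].
  exfalso. apply (f_equal cos) in h.
  rewrite cos_acos, cos_PI in h by exact Hb. rewrite h in H1.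
  assert (H0 : Im z / Cmod z = 0) by nra.
  apply Hy. apply Rmult_integral in H0. destruct H0; lra. }
unfold arg; destruct s.
- destruct (Rle_dec 0 (Im z)) as [h|h]; [lra|].
  assert (Hy : Im z <> 0) by lra. specialize (Hlt Hy). lra.
- destruct (Rlt_dec 0 (Im z)) as [h|h]; [|lra].
  assert (Hy : Im z <> 0) by lra. specialize (Hlt Hy). lra.
Qed.

(** ** Vectors in the plane *)

Definition vec : Type := (R * R)%type.

Definition vscal (t : R) (x : vec) : vec := (t * fst x, t * snd x).

Definition vadd (x y : vec) : vec := (fst x + fst y, snd x + snd y).

Definition star (phi : R) (x y : vec) : C :=
  (cis phi * (fst x * fst y)%R + (snd x * snd y)%R)%C.

Definition edot (x y : vec) : R := fst x * fst y + snd x * snd y.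

Definition mdot (x y : vec) : R := - (fst x * fst y) + snd x * snd y.

Lemma star_0 (x y : vec) : star 0 x y = RtoC (edot x y).
Proof.
unfold star, cis, edot, Cplus, Cmult, RtoC; rewrite cos_0, sin_0; cbn [fst snd].
f_equal; ring.
Qed.

Lemma star_PI (x y : vec) : star PI x y = RtoC (mdot x y).
Proof.
unfold star, cis, mdot, Cplus, Cmult, RtoC; rewrite cos_PI, sin_PI; cbn [fst snd].
f_equal; ring.
Qed.

Definition null (x : vec) : Prop := mdot x x = 0.

Definition antiparallel (a b : vec) : Prop :=
  exists t : R, t < 0 /\ b = vscal t a.

Definition area (a b : vec) : R := / 2 * Rabs (fst a * snd b - snd a * fst b).

(** ** Complex dihedral angles *)

Definition dihedral_formula (a b : vec) (phi : R) : C :=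
  (- Ci * Clog ((star phi a b
                 + Csqrt (star phi a b ^ 2 - star phi a a * star phi b b))
                / (Csqrt (star phi a a) * Csqrt (star phi b b))))%C.

(** theta^+ is [dihedral Upper] and theta^- is [dihedral Lower], on their
    respective domains. *)
Definition dihedral (s : pm) (a b : vec) (phi : R) : C :=
  if excluded_middle_informative (antiparallel a b)
  then RtoC (- pmR s * PI)
  else dihedral_formula a b phi.

Definition dihedral_domain (s : pm) (phi : R) : Prop :=
  match s with
  | Upper => 0 < phi < PI
  | Lower => - PI < phi < 0
  end.

(** ** Analytic continuation *)

Definition real_analytic (f : R -> C) : Prop :=
  forall x0 : R, exists (c : nat -> C) (r : posreal),
    forall x : R, Rabs (x - x0) < r ->
      @is_pseries R_AbsRing C_R_NormedModule c (x - x0) (f x).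

(** [g] is an analytic continuation to the whole real line of the function [f],
    which is only meaningful on [D]. *)
Definition analytic_continuation (D : R -> Prop) (f g : R -> C) : Prop :=
  real_analytic g /\ forall phi : R, D phi -> g phi = f phi.

(** ** Light rays in the wedge *)

Definition half_line (d x : vec) : Prop :=
  exists t : R, 0 <= t /\ x = vscal t d.

(** Directions of the four light rays. *)
Definition light_directions : list vec :=
  (1, 1) :: (1, -1) :: (-1, 1) :: (-1, -1) :: nil.

Lemma null_light_rays (x : vec) :
  null x <-> exists d : vec, In d light_directions /\ half_line d x.
Proof.
destruct x as [x0 x1]; unfold null, mdot, light_directions, half_line, vscal.
cbn [fst snd In]; split.
- intros H.
  assert (H' : (x1 - x0) * (x1 + x0) = 0) by lra.
  apply Rmult_integral in H'.
  destruct (Rle_dec 0 x0) as [h|h]; destruct H' as [e|e].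
  + exists (1, 1); split; [tauto|]; exists x0; cbn; split; [lra|f_equal; lra].
  + exists (1, -1); split; [tauto|]; exists x0; cbn; split; [lra|f_equal; lra].
  + exists (-1, -1); split; [tauto|]; exists (- x0); cbn; split; [lra|f_equal; lra].
  + exists (-1, 1); split; [tauto|]; exists (- x0); cbn; split; [lra|f_equal; lra].
- intros [d [Hd [t [_ e]]]]; injection e; intros -> ->.
  destruct Hd as [<-|[<-|[<-|[<-|[]]]]]; cbn; ring.
Qed.

Definition wedge (a b x : vec) : Prop :=
  exists s t : R, 0 <= s /\ 0 <= t /\ x = vadd (vscal s a) (vscal t b).

Definition light_ray_in_wedge (a b d : vec) : Prop :=
  forall x : vec, half_line d x -> wedge a b x.

(** The wedge of antiparallel vectors is read as a half-plane, although the cone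
    [wedge] degenerates to a line. *)
Definition N_c (a b : vec) : nat :=
  if excluded_middle_informative (antiparallel a b) then 2%nat
  else length (filter
    (fun d => if excluded_middle_informative (light_ray_in_wedge a b d)
              then true else false)
    light_directions).

(** ** The expression inside the logarithm of the continued angles *)

Definition dihedral_arg (s : pm) (a b : vec) (phi : R) : C :=
  ((star phi a b - pmR s * 2 * Ci * cis (phi / 2) * area a b)
   / (Csqrt (star phi a a) * Csqrt (star phi b b)))%C.

(** ** Euclidean and Lorentzian angles *)

Definition psi_E (a b : vec) : R :=
  acos (edot a b / (sqrt (edot a a) * sqrt (edot b b))).

Definition arcosh (u : R) : R := ln (u + sqrt (u ^ 2 - 1)).

Lemma arcosh_spec (u : R) : 1 <= u -> 0 <= arcosh u /\ cosh (arcosh u) = u.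
Proof.
intros Hu; unfold arcosh.
pose proof (sqrt_pos (u ^ 2 - 1)) as Hp.
assert (Hs : sqrt (u ^ 2 - 1) * sqrt (u ^ 2 - 1) = u ^ 2 - 1)
  by (apply sqrt_sqrt; nra).
set (w := sqrt (u ^ 2 - 1)) in *.
split.
- rewrite <- ln_1. destruct (Req_dec (u + w) 1) as [->|h]; [lra|].
  left; apply ln_increasing; lra.
- unfold cosh. rewrite exp_Ropp, exp_ln by lra.
  replace (/ (u + w)) with (u - w); [field|].
  apply (Rmult_eq_reg_l (u + w)); [|lra]. rewrite Rinv_r by lra. nra.
Qed.

Definition hat (x : vec) : vec := vscal (/ sqrt (Rabs (mdot x x))) x.

Inductive quadrant : Set := QI | QII | QIII | QIV.

(** Only meaningful for vectors that are not null, see [quadrant_ofP]. *)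
Definition quadrant_of (x : vec) : quadrant :=
  if Rlt_dec (Rabs (fst x)) (snd x) then QI
  else if Rlt_dec (Rabs (snd x)) (fst x) then QII
  else if Rlt_dec (snd x) (- Rabs (fst x)) then QIII
  else QIV.

Definition in_quadrant (q : quadrant) (x : vec) : Prop :=
  match q with
  | QI => snd x > Rabs (fst x)
  | QII => fst x > Rabs (snd x)
  | QIII => snd x < - Rabs (fst x)
  | QIV => fst x < - Rabs (snd x)
  end.

Lemma quadrant_ofP (x : vec) (q : quadrant) :
  ~ null x -> (quadrant_of x = q <-> in_quadrant q x).
Proof.
destruct x as [x0 x1]; unfold null, mdot; cbn [fst snd]; intros Hx.
assert (H1 : x1 <> x0) by (intros ->; apply Hx; ring).
assert (H2 : x1 <> - x0) by (intros ->; apply Hx; ring).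
unfold quadrant_of, in_quadrant; cbn [fst snd].
destruct (Rlt_dec (Rabs x0) x1); [|destruct (Rlt_dec (Rabs x1) x0);
  [|destruct (Rlt_dec x1 (- Rabs x0))]];
destruct q; split; intros H; try discriminate; try reflexivity;
  unfold Rabs in *; destruct (Rcase_abs x0); destruct (Rcase_abs x1);
  try (exfalso; lra); lra.
Qed.

(** psi_{L+} is [psi_L Upper] and psi_{L-} is [psi_L Lower]. The last case is
    that of neighbouring quadrants. *)
Definition psi_L (s : pm) (a b : vec) : C :=
  let u := mdot (hat a) (hat b) in
  match quadrant_of a, quadrant_of b with
  | QI, QI | QIII, QIII => RtoC (arcosh u)
  | QI, QIII | QIII, QI => (- arcosh (- u) - pmR s * PI * Ci)%C
  | QII, QII | QIV, QIV => RtoC (- arcosh (- u))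
  | QII, QIV | QIV, QII => (arcosh u - pmR s * PI * Ci)%C
  | _, _ => (arcsinh u - pmR s * (PI / 2)%R * Ci)%C
  end.

(* Main.v *)
Require Import Defs.
From Stdlib Require Import Lra Lia ClassicalEpsilon.

(** Let w = exp (i phi / 2).  Each vector x has complex polar coordinates:
    with S = sqrt (x star x), the equations x_1 = S cos gamma and
    w x_0 = S sin gamma, i.e. x_1 + i w x_0 = S exp (i gamma) and
    x_1 - i w x_0 = S exp (- i gamma), are solved by gamma = p + g(phi), where
    p is the (constant) angle of the axis of the quadrant of x and g, a branch
    of arctan (w x_0 / x_1) or - arctan (x_1 / (w x_0)), is real-analytic on
    the whole line because x is not null.  Since
    a star b +- i w det(a, b) = S_a S_b exp (+- i (gamma_a - gamma_b)), the
    dihedral angle theta^+ continues to - PI N_c / 2 - e (g_a - g_b), where e is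
    the sign of det(a, b), and theta^- to its opposite.  Conjugation symmetry
    and the sign change g(phi + 2 PI) = - g(phi) give the other properties, and
    the branch of the logarithm is read off from the bound |Re g| < PI / 4. *)

(** * Real analytic functions *)

(** The principal roots and logarithm of the defining formula jump as phi varies, so that formula
    cannot simply be followed along the line. The closed form is built first and compared with the
    principal branches only for phi in (- PI, PI]; the outer range then comes from the shift by 2
    PI. Arbitrary continuations are covered by an identity theorem for real power series. The
    formula for g comes from exp (2 i gamma) = (x_1 + i w x_0) / (x_1 - i w x_0). The squared moduli
    of numerator and denominator are x_0^2 + x_1^2 - 2 x_0 x_1 sin (phi / 2) and x_0^2 + x_1^2 + 2
    x_0 x_1 sin (phi / 2), both positive; the numerator times the conjugate of the denominator is
    x_1^2 - x_0^2 + 2 i x_0 x_1 cos (phi / 2), whose real part is a non-zero constant. So real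
    arctangents and logarithms suffice, without a cut to cross, and the bound PI / 4 is half of the
    bound on the arctangent. *)

Definition analytic_at (f : R -> R) (x0 : R) : Prop :=
  exists (c : nat -> R) (r : posreal),
    forall h : R, Rabs h < r -> is_pseries c h (f (x0 + h)).

(** If the radius were at most [Rabs h], the terms at the midpoint of [Rabs h] and [r] would not
    tend to 0. The strict inequality is what products, integrals and continuity of power series
    require. *)
Lemma CV_radius_gt c r : (forall h, Rabs h < r -> ex_pseries c h) ->
  forall h, Rabs h < r -> Rbar_lt (Rabs h) (CV_radius c).
Proof.
intros H h Hh. apply Rbar_not_le_lt. intros Hle.
set (y := (Rabs h + r) / 2).
assert (Hy : Rabs h < y < r) by (unfold y; lra).
pose proof (Rabs_pos h).
assert (Ey : Rabs y = y) by (apply Rabs_pos_eq; lra).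
apply (CV_disk_outside c y).
- rewrite Ey. eapply Rbar_le_lt_trans; [exact Hle|]. simpl; lra.
- apply ex_series_lim_0.
  destruct (H y) as [l Hl]; [rewrite Ey; lra|].
  exists l. apply is_pseries_R, Hl.
Qed.

Lemma is_pseries_C (u v : nat -> R) (h p q : R) :
  is_pseries u h p -> is_pseries v h q ->
  @is_pseries R_AbsRing C_R_NormedModule (fun n => (u n, v n)) h (p, q).
Proof.
unfold is_pseries, is_series. intros Hu Hv.
apply filterlim_ext with
  (fun n => (sum_n (fun k => scal (pow_n h k) (u k)) n,
             sum_n (fun k => scal (pow_n h k) (v k)) n)).
- induction x as [|n IH].
  + rewrite !sum_O. reflexivity.
  + rewrite !sum_Sn. rewrite <- IH. reflexivity.
- intros P [e He].
  assert (H1 := Hu (ball p e) (locally_ball p e)).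
  assert (H2 := Hv (ball q e) (locally_ball q e)).
  unfold filtermap in *. generalize (filter_and _ _ H1 H2).
  apply filter_imp. intros n [A B]. apply He. split; assumption.
Qed.

Lemma is_pseries_C_components (c : nat -> C) (h : R) (z : C) :
  @is_pseries R_AbsRing C_R_NormedModule c h z ->
  is_pseries (fun n => fst (c n)) h (fst z) /\ is_pseries (fun n => snd (c n)) h (snd z).
Proof.
unfold is_pseries, is_series. intros H.
assert (E : forall n, sum_n (fun k => @scal R_AbsRing C_R_NormedModule (pow_n h k) (c k)) n =
  (sum_n (fun k => scal (pow_n h k) (fst (c k))) n, sum_n (fun k => scal (pow_n h k) (snd (c k))) n)).
{ induction n as [|n IH].
  + rewrite !sum_O. reflexivity.
  + rewrite !sum_Sn. rewrite IH. reflexivity. }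
split; intros P [e He]; generalize (H (ball z e) (locally_ball z e)); unfold filtermap;
apply filter_imp; intros n Hn; apply He; rewrite E in Hn; apply Hn.
Qed.


Lemma analytic_at_plus f g x0 : analytic_at f x0 -> analytic_at g x0 -> analytic_at (fun x => f x + g x) x0.
Proof.
intros [c [r H]] [d [q K]].
exists (PS_plus c d), (mkposreal (Rmin r q) (Rmin_stable_in_posreal r q)).
intros h Hh. simpl in Hh. apply (is_pseries_plus c d); [apply H | apply K];
(eapply Rlt_le_trans; [exact Hh|]); [apply Rmin_l|apply Rmin_r].
Qed.

Lemma analytic_at_mult f g x0 : analytic_at f x0 -> analytic_at g x0 -> analytic_at (fun x => f x * g x) x0.
Proof.
intros [c [r H]] [d [q K]].
exists (PS_mult c d), (mkposreal (Rmin r q) (Rmin_stable_in_posreal r q)).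
intros h Hh. simpl in Hh.
assert (Hr : Rabs h < r) by (eapply Rlt_le_trans; [exact Hh | apply Rmin_l]).
assert (Hq : Rabs h < q) by (eapply Rlt_le_trans; [exact Hh | apply Rmin_r]).
apply is_pseries_mult; [apply H, Hr | apply K, Hq | |].
- apply (CV_radius_gt c r); [|exact Hr]. intros y Hy. eexists; apply H, Hy.
- apply (CV_radius_gt d q); [|exact Hq]. intros y Hy. eexists; apply K, Hy.
Qed.

Lemma is_pseries_const (k h : R) :
  is_pseries (fun n => match n with O => k | _ => 0 end) h k.
Proof.
unfold is_pseries, is_series.
apply filterlim_ext with (fun _ : nat => k); [|apply filterlim_const].
induction x as [|n IH]; [rewrite sum_O|rewrite sum_Sn, <- IH];
unfold scal, plus; simpl; unfold mult, one; simpl; ring.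
Qed.

Lemma analytic_at_const k x0 : analytic_at (fun _ => k) x0.
Proof.
exists (fun n => match n with O => k | _ => 0 end), (mkposreal 1 Rlt_0_1).
intros h _. apply is_pseries_const.
Qed.

(** Termwise integration of the series of [g] gives [f (x0 + h) - f x0]. The lemma serves for [atan]
    and [ln] of trigonometric expressions: their derivatives are rational in sine and cosine, so
    sums, products and inverses of series are enough. *)
Lemma analytic_at_primitive f g x0 : (forall x, is_derive f x (g x)) ->
  analytic_at g x0 -> analytic_at f x0.
Proof.
intros Hd [c [r H]].
assert (Hr : forall h, Rabs h < r -> Rbar_lt (Rabs h) (CV_radius c)).
{ apply CV_radius_gt. intros h Hh. eexists; apply H, Hh. }
exists (PS_plus (fun n => match n with O => f x0 | _ => 0 end) (PS_Int c)), r.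
intros h Hh.
replace (f (x0 + h)) with (plus (f x0) (PSeries (PS_Int c) h)).
{ apply is_pseries_plus; [apply is_pseries_const|].
  apply PSeries_correct, CV_radius_inside. rewrite CV_radius_Int. apply Hr, Hh. }
assert (I1 := is_RInt_PSeries c h (Hr h Hh)).
assert (I2 : is_RInt (PSeries c) 0 h (minus (f (x0 + h)) (f (x0 + 0)))).
{ apply (is_RInt_derive (fun t => f (x0 + t)) (PSeries c)).
  - intros x Hx. assert (Hx' : Rabs x < r).
    { eapply Rle_lt_trans; [|exact Hh]. revert Hx.
      unfold Rmin, Rmax, Rabs; destruct (Rle_dec 0 h), (Rcase_abs x), (Rcase_abs h); lra. }
    rewrite (is_pseries_unique _ _ _ (H x Hx')).
    evar_last. { apply is_derive_comp; [apply Hd|]. auto_derive; [exact I|reflexivity]. }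
    unfold scal; simpl; unfold mult; simpl; ring.
  - intros x Hx. assert (Hx' : Rabs x < r).
    { eapply Rle_lt_trans; [|exact Hh]. revert Hx.
      unfold Rmin, Rmax, Rabs; destruct (Rle_dec 0 h), (Rcase_abs x), (Rcase_abs h); lra. }
    apply continuity_pt_filterlim, PSeries_continuity, Hr, Hx'. }
assert (E := eq_trans (eq_sym (is_RInt_unique _ _ _ _ I1)) (is_RInt_unique _ _ _ _ I2)).
rewrite E. unfold plus, minus, opp; simpl. rewrite Rplus_0_r. unfold plus; simpl; ring.
Qed.

(* [PS_inv_upto c n] is correct up to index [n] only: the coefficient of index
   [n] of the inverse series needs all the previous ones. *)
Fixpoint PS_inv_upto (c : nat -> R) (n : nat) : nat -> R :=
  match n with
  | O => fun _ => / c O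
  | S m => fun k => if (k <=? m)%nat then PS_inv_upto c m k
     else - / c O * sum_f_R0 (fun j => PS_inv_upto c m j * c (S m - j)%nat) m
  end.

Definition PS_inv (c : nat -> R) (n : nat) : R := PS_inv_upto c n n.

Lemma PS_inv_upto_le c n k : (k <= n)%nat -> PS_inv_upto c n k = PS_inv c k.
Proof.
induction n as [|n IH]; intros Hk.
- replace k with O by lia. reflexivity.
- destruct (Nat.eq_dec k (S n)) as [->|Hne]; [reflexivity|].
  cbn [PS_inv_upto]. destruct (Nat.leb_spec k n); [apply IH; assumption | lia].
Qed.

Lemma PS_inv_S c n :
  PS_inv c (S n) = - / c O * sum_f_R0 (fun j => PS_inv c j * c (S n - j)%nat) n.
Proof.
unfold PS_inv at 1. cbn [PS_inv_upto].
destruct (Nat.leb_spec (S n) n); [lia|]. f_equal.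
apply sum_eq. intros j Hj. rewrite PS_inv_upto_le by exact Hj. reflexivity.
Qed.

Lemma PS_mult_inv c n : c O <> 0 ->
  PS_mult (PS_inv c) c n = match n with O => 1 | _ => 0 end.
Proof.
intros Hc. unfold PS_mult. destruct n as [|n].
- simpl. unfold PS_inv. simpl. field; exact Hc.
- rewrite tech5, PS_inv_S, Nat.sub_diag. field; exact Hc.
Qed.

(** Strong induction on the recursion: the bounds [(1 + K) ^ j] form a geometric sum, whose
    denominator cancels the factor [K] and leaves [(1 + K) ^ S n - 1]. *)
Lemma PS_inv_bound c B K : c O <> 0 -> 0 < B -> 0 < K ->
  (forall n, Rabs (c n) <= Rabs (c O) * K * B ^ n) ->
  forall n, Rabs (PS_inv c n) <= / Rabs (c O) * (B * (1 + K)) ^ n.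
Proof.
intros Hc HB HK Hb.
assert (Hm : 0 < Rabs (c O)) by (apply Rabs_pos_lt, Hc).
assert (Hi : 0 < / Rabs (c O)) by (apply Rinv_0_lt_compat, Hm).
intros n. induction n as [n IH] using (well_founded_induction Wf_nat.lt_wf).
destruct n as [|n].
- unfold PS_inv; simpl. rewrite Rabs_inv. lra.
- rewrite PS_inv_S, Rabs_mult, Rabs_Ropp, Rabs_inv.
  apply Rmult_le_compat_l; [lra|].
  eapply Rle_trans; [apply Rsum_abs|].
  apply Rle_trans with
    (sum_f_R0 (fun j => (1 + K) ^ j * (K * B ^ S n)) n).
  { apply sum_Rle. intros j Hj. rewrite Rabs_mult.
    eapply Rle_trans.
    { apply Rmult_le_compat; try apply Rabs_pos; [apply IH; lia | apply Hb]. }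
    right. rewrite Rpow_mult_distr.
    replace (B ^ S n) with (B ^ j * B ^ (S n - j)) by (rewrite <- pow_add; f_equal; lia).
    field. lra. }
  rewrite <- scal_sum, tech3 by lra.
  rewrite (Rpow_mult_distr B). replace (1 - (1 + K)) with (- K) by ring.
  apply Rle_trans with (B ^ S n * ((1 + K) ^ S n - 1)).
  { right. field. lra. }
  apply Rmult_le_compat_l; [left; apply pow_lt, HB | lra].
Qed.

Lemma analytic_at_inv f x0 : f x0 <> 0 -> analytic_at f x0 -> analytic_at (fun x => / f x) x0.
Proof.
intros Hf [c [r H]].
assert (Hr0 := cond_pos r).
assert (Hr : forall h, Rabs h < r -> Rbar_lt (Rabs h) (CV_radius c)).
{ apply CV_radius_gt. intros h Hh. eexists; apply H, Hh. }
assert (Hc : c O <> 0).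
{ assert (H0 : Rabs 0 < r) by (rewrite Rabs_R0; exact Hr0).
  rewrite <- PSeries_0, (is_pseries_unique _ _ _ (H 0 H0)), Rplus_0_r. exact Hf. }
(* The series converges at [p], so its terms there are bounded. This is the Cauchy estimate that
   feeds [PS_inv_bound] with the ratio [/ p]. *)
set (p := r / 2). assert (Hp : 0 < p < r) by (unfold p; lra).
assert (Hb : exists K, 0 < K /\ forall n, Rabs (c n * p ^ n) <= K).
{ apply maj_by_pos. exists 0. apply is_lim_seq_Reals, ex_series_lim_0.
  assert (E : Rabs p < r) by (rewrite Rabs_pos_eq; lra).
  eexists. apply is_pseries_R, H, E. }
destruct Hb as [K [HK Hb]].
assert (Hm : 0 < Rabs (c O)) by (apply Rabs_pos_lt, Hc).
assert (Hip : 0 < / p) by (apply Rinv_0_lt_compat; lra).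
set (K' := K / Rabs (c O)).
assert (HK' : 0 < K') by (apply Rdiv_lt_0_compat; assumption).
assert (HQ : 0 < / p * (1 + K')) by (apply Rmult_lt_0_compat; lra).
assert (Hd := PS_inv_bound c (/ p) K' Hc Hip HK').
set (Q := / p * (1 + K')) in *.
assert (Hq0 : 0 < Rmin r (/ Q)).
{ apply Rmin_glb_lt; [exact Hr0 | apply Rinv_0_lt_compat, HQ]. }
assert (Hd' : forall h, Rabs h < Rmin r (/ Q) -> ex_pseries (PS_inv c) h).
{ intros h Hh. apply (ex_series_le (V := R_CompleteNormedModule) (fun k => pow_n h k * PS_inv c k) (fun n => / Rabs (c O) * (Q * Rabs h) ^ n)).
  - intros n. change (Rabs (pow_n h n * PS_inv c n) <= / Rabs (c O) * (Q * Rabs h) ^ n).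
    rewrite pow_n_pow, Rabs_mult, <- RPow_abs, Rpow_mult_distr.
    rewrite (Rmult_comm (Q ^ n)), <- Rmult_assoc, (Rmult_comm (/ _)), Rmult_assoc.
    apply Rmult_le_compat_l; [apply pow_le, Rabs_pos|].
    apply Hd. intros k. unfold K'.
    apply (Rmult_le_reg_r (p ^ k)); [apply pow_lt; lra|].
    rewrite pow_inv. assert (0 < p ^ k) by (apply pow_lt; lra).
    replace (Rabs (c 0%nat) * (K / Rabs (c 0%nat)) * / p ^ k * p ^ k) with K by (field; lra).
    rewrite <- (Rabs_pos_eq (p ^ k)) at 1 by lra. rewrite <- Rabs_mult. apply Hb.
  - apply (ex_series_scal (V := R_NormedModule)), ex_series_geom.
    assert (Hh' : Rabs h < / Q) by (eapply Rlt_le_trans; [exact Hh | apply Rmin_r]).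
    pose proof (Rabs_pos h). rewrite Rabs_pos_eq by (apply Rmult_le_pos; lra).
    apply (Rmult_lt_compat_l Q) in Hh'; [|exact HQ]. rewrite Rinv_r in Hh'; lra. }
exists (PS_inv c), (mkposreal _ Hq0). simpl. intros h Hh.
assert (Hh' : Rabs h < r) by (eapply Rlt_le_trans; [exact Hh | apply Rmin_l]).
assert (P := is_pseries_mult _ _ h _ _ (PSeries_correct _ _ (Hd' h Hh)) (H h Hh')
  (CV_radius_gt _ _ Hd' h Hh) (Hr h Hh')).
apply (is_pseries_ext _ _ _ _ (fun n => PS_mult_inv c n Hc)) in P.
assert (P1 := is_pseries_unique _ _ _ (is_pseries_const 1 h)).
apply is_pseries_unique in P. assert (P2 := eq_trans (eq_sym P) P1). clear P P1; rename P2 into P.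
(* That [f] does not vanish near [x0] follows from the Cauchy product being 1, once both series
   converge. *)
assert (Hne : f (x0 + h) <> 0) by (intros E; rewrite E, Rmult_0_r in P; lra).
replace (/ f (x0 + h)) with (PSeries (PS_inv c) h).
- apply PSeries_correct, Hd', Hh.
- apply (Rmult_eq_reg_r (f (x0 + h))); [|exact Hne]. rewrite P. symmetry. apply Rinv_l, Hne.
Qed.

(** [cos] and [sin] are defined through series in the square of the variable, so their coefficients
    are spread over the even and the odd indices, with 0 in between. *)
Lemma ex_pseries_trig : exists c s : nat -> R,
  forall h, is_pseries c h (cos h) /\ is_pseries s h (sin h).
Proof.
exists (fun n => if Nat.even n then cos_n (Nat.div2 n) else 0).
exists (fun n => if Nat.even n then 0 else sin_n (Nat.div2 n)).
assert (E1 : forall n, Nat.even (2 * n) = true).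
{ intros n. apply Nat.even_spec. exists n; lia. }
assert (E2 : forall n, Nat.even (2 * n + 1) = false).
{ intros n. rewrite Nat.add_1_r, Nat.even_succ, <- Nat.negb_even, E1. reflexivity. }
assert (D1 : forall n, Nat.div2 (2 * n) = n) by (intros; apply Nat.div2_double).
assert (D2 : forall n, Nat.div2 (2 * n + 1) = n).
{ intros. rewrite Nat.add_1_r. apply Nat.div2_succ_double. }
assert (Z : forall h, is_pseries (fun _ : nat => 0) h 0).
{ intros h. apply (is_pseries_ext (fun n => match n with O => 0 | _ => 0 end)).
  - intros [|n]; reflexivity.
  - apply is_pseries_const. }
intros h. split.
- replace (cos h) with (cos h + h * 0) by ring. apply is_pseries_odd_even.
  + apply is_pseries_R, is_series_Reals. unfold cos.
    destruct (exist_cos h²) as [l Hl]. unfold cos_in in Hl.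
    apply is_series_Reals in Hl. apply is_series_Reals.
    eapply is_series_ext; [|exact Hl]. intros n. cbv beta. rewrite E1, D1. unfold Rsqr.
    simpl (h ^ 2). rewrite Rmult_1_r. reflexivity.
  + eapply is_pseries_ext; [|apply Z]. intros n. cbv beta. rewrite E2. reflexivity.
- unfold sin. destruct (exist_sin h²) as [l Hl]. rewrite <- (Rplus_0_l (h * l)). apply is_pseries_odd_even.
  + eapply is_pseries_ext; [|apply Z]. intros n. cbv beta. rewrite E1. reflexivity.
  + apply is_pseries_R, is_series_Reals. unfold sin_in in Hl.
    apply is_series_Reals in Hl. apply is_series_Reals.
    eapply is_series_ext; [|exact Hl]. intros n. cbv beta. rewrite E2, D2. unfold Rsqr.
    simpl (h ^ 2). rewrite Rmult_1_r. reflexivity.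
Qed.

Lemma analytic_at_ext f g x0 : (forall x, f x = g x) -> analytic_at f x0 -> analytic_at g x0.
Proof.
intros E [c [r H]]. exists c, r. intros h Hh. rewrite <- E. apply H, Hh.
Qed.

Lemma is_pseries_rescale c k h l :
  is_pseries c (k * h) l -> is_pseries (fun n => c n * k ^ n) h l.
Proof.
rewrite !is_pseries_R. apply is_series_ext. intros n. rewrite Rpow_mult_distr. simpl. ring.
Qed.

Lemma analytic_at_cos k x0 : analytic_at (fun x => cos (k * x)) x0.
Proof.
destruct ex_pseries_trig as [c [s H]].
exists (PS_plus (PS_scal (cos (k * x0)) (fun n => c n * k ^ n))
   (PS_scal (- sin (k * x0)) (fun n => s n * k ^ n))), (mkposreal 1 Rlt_0_1).
intros h _.
replace (cos (k * (x0 + h))) with (cos (k * x0) * cos (k * h) + - sin (k * x0) * sin (k * h)).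
2: rewrite Rmult_plus_distr_l, cos_plus; ring.
apply (is_pseries_plus (V := R_NormedModule)); apply (is_pseries_scal (V := R_NormedModule));
try apply Rmult_comm; apply is_pseries_rescale, H.
Qed.

Lemma analytic_at_sin k x0 : analytic_at (fun x => sin (k * x)) x0.
Proof.
destruct ex_pseries_trig as [c [s H]].
exists (PS_plus (PS_scal (sin (k * x0)) (fun n => c n * k ^ n))
   (PS_scal (cos (k * x0)) (fun n => s n * k ^ n))), (mkposreal 1 Rlt_0_1).
intros h _.
rewrite Rmult_plus_distr_l, sin_plus.
apply (is_pseries_plus (V := R_NormedModule)); apply (is_pseries_scal (V := R_NormedModule));
try apply Rmult_comm; apply is_pseries_rescale, H.
Qed.

(* [Z] may accumulate at 0 from one side only, as it does in [analytic_zero_ray]. *)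
Lemma PS_coeff_eq_0 (Z : R -> Prop) (r : R) : 0 < r ->
  (forall e, 0 < e -> exists h, 0 < Rabs h < e /\ Z h) ->
  forall n (c : nat -> R), (forall h, Rabs h < r -> ex_pseries c h) ->
  (forall h, Z h -> 0 < Rabs h < r -> is_pseries c h 0) ->
  c n = 0.
Proof.
intros Hr Hacc.
assert (H0 : forall c : nat -> R, (forall h, Rabs h < r -> ex_pseries c h) ->
  (forall h, Z h -> 0 < Rabs h < r -> is_pseries c h 0) -> c O = 0).
{ intros c Hex Hz. destruct (Req_dec (c O) 0) as [E|E]; [exact E|exfalso].
  assert (Hc : continuity_pt (PSeries c) 0).
  { apply PSeries_continuity, (CV_radius_gt c r Hex). rewrite Rabs_R0; exact Hr. }
  destruct (Hc (Rabs (c O)) (Rabs_pos_lt _ E)) as [d [Hd Hcd]].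
  destruct (Hacc (Rmin d r)) as [h [[Hh0 Hh] HZ]]; [apply Rmin_glb_lt; assumption|].
  assert (Hhd : Rabs h < d) by (eapply Rlt_le_trans; [exact Hh | apply Rmin_l]).
  assert (Hhr : Rabs h < r) by (eapply Rlt_le_trans; [exact Hh | apply Rmin_r]).
  specialize (Hcd h). simpl in Hcd. unfold Rdist in Hcd.
  rewrite PSeries_0, (is_pseries_unique _ _ _ (Hz h HZ (conj Hh0 Hhr))) in Hcd.
  replace (0 - c O) with (- c O) in Hcd by ring. rewrite Rabs_Ropp in Hcd.
  apply (Rlt_irrefl (Rabs (c O))), Hcd. split.
  - split; [exact I | intros E'; rewrite <- E', Rabs_R0 in Hh0; lra].
  - rewrite Rminus_0_r. exact Hhd. }
(* As the constant coefficient vanishes, dividing by [h] gives the shifted series, which still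
   vanishes on [Z]; hence the induction generalizes over [c]. *)
induction n as [|n IH]; intros c Hex Hz; [apply H0; assumption|].
apply (IH (PS_decr_1 c)).
- intros h Hh. apply (ex_pseries_decr_1 (V := R_NormedModule)).
  + destruct (Req_dec h 0) as [E|E]; [left; exact E | right; exists (/ h)].
    apply Rinv_l, E.
  + apply Hex, Hh.
- intros h HZ Hh.
  replace 0 with (/ h * (0 + - c O)) by (rewrite (H0 c Hex Hz); ring).
  apply (is_pseries_decr_1 (V := R_NormedModule)); [|apply Hz; assumption].
  apply Rinv_l. intros ->. rewrite Rabs_R0 in Hh; lra.
Qed.

(** Let [S] be the supremum of the lengths up to which [f] vanishes. The zeros accumulate at
    distance [S], so the power series there has only zero coefficients and [f] vanishes beyond [S],
    a contradiction. *)
Lemma analytic_zero_ray f m sg d : (forall x, analytic_at f x) -> Rabs sg = 1 -> 0 < d ->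
  (forall y, 0 <= y <= d -> f (m + sg * y) = 0) ->
  forall y, 0 <= y -> f (m + sg * y) = 0.
Proof.
intros Han Hsg Hd Hf y Hy.
destruct (Req_dec (f (m + sg * y)) 0) as [E|E]; [exact E|exfalso].
set (P := fun u => 0 <= u /\ forall z, 0 <= z <= u -> f (m + sg * z) = 0).
assert (HPd : P d) by (split; [lra | exact Hf]).
destruct (completeness P) as [S [HS1 HS2]].
{ exists y. intros u [Hu Hz]. destruct (Rle_dec u y); [assumption|].
  exfalso. apply E, Hz; lra. }
{ exists d. exact HPd. }
assert (HdS : d <= S) by (apply HS1, HPd).
assert (Hz : forall z, 0 <= z < S -> f (m + sg * z) = 0).
{ intros z Hz. destruct (Req_dec (f (m + sg * z)) 0) as [E'|E']; [exact E'|exfalso].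
  assert (S <= z); [|lra]. apply HS2. intros u [Hu Hu'].
  destruct (Rle_dec u z); [assumption|]. exfalso. apply E', Hu'; lra. }
destruct (Han (m + sg * S)) as [c [r H]].
assert (Hr := cond_pos r).
assert (Hc : forall n, c n = 0).
{ intros n. apply (PS_coeff_eq_0 (fun h => exists z, 0 <= z < S /\ h = sg * (z - S)) r Hr).
  (* The maximum with 0 keeps the point on the ray when [e] is large. *)
  - intros e He. exists (sg * (Rmax 0 (S - e / 2) - S)).
    assert (Hm := Rmax_l 0 (S - e / 2)). assert (Hm' := Rmax_r 0 (S - e / 2)).
    assert (Hm2 : Rmax 0 (S - e / 2) < S) by (apply Rmax_lub_lt; lra).
    split; [|exists (Rmax 0 (S - e / 2)); split; [lra|reflexivity]].
    rewrite Rabs_mult, Hsg, Rabs_left by lra. lra.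
  - intros h Hh. eexists. apply H, Hh.
  - intros h [z [Hzz ->]] Hh. rewrite <- (Hz z Hzz).
    replace (m + sg * z) with (m + sg * S + sg * (z - S)) by ring.
    apply H, Hh. }
assert (HP : P (S + r / 2)).
{ split; [lra|]. intros z Hzz. destruct (Rlt_dec z S); [apply Hz; lra|].
  replace (m + sg * z) with (m + sg * S + sg * (z - S)) by ring.
  assert (Hh : Rabs (sg * (z - S)) < r).
  { rewrite Rabs_mult, Hsg, Rabs_pos_eq; lra. }
  rewrite <- (is_pseries_unique _ _ _ (H _ Hh)).
  rewrite (PSeries_ext _ (fun _ => 0)) by exact Hc. apply PSeries_const_0. }
apply HS1 in HP. lra.
Qed.

Lemma analytic_identity f p q : (forall x, analytic_at f x) -> p < q ->
  (forall x, p < x < q -> f x = 0) -> forall x, f x = 0.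
Proof.
intros Han Hpq Hf x. set (m := (p + q) / 2). set (d := (q - p) / 4).
destruct (Rle_dec m x) as [Hx|Hx].
- replace x with (m + 1 * (x - m)) by ring.
  apply (analytic_zero_ray f m 1 d Han); unfold m, d; try lra; [apply Rabs_R1 | |].
  + intros y Hy. apply Hf; lra.
  + unfold m in Hx; lra.
- replace x with (m + -1 * (m - x)) by ring.
  apply (analytic_zero_ray f m (-1) d Han); unfold m, d; try lra; [rewrite Rabs_left; lra | |].
  + intros y Hy. apply Hf; lra.
  + unfold m in Hx; lra.
Qed.

Lemma real_analytic_iff (f : R -> C) :
  real_analytic f <-> forall x, analytic_at (fun y => fst (f y)) x /\ analytic_at (fun y => snd (f y)) x.
Proof.
split.
- intros H x. destruct (H x) as [c [r Hc]].
  assert (Hh : forall h, Rabs h < r -> is_pseries (fun n => fst (c n)) h (fst (f (x + h))) /\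
     is_pseries (fun n => snd (c n)) h (snd (f (x + h)))).
  { intros h Hh. apply is_pseries_C_components. specialize (Hc (x + h)). replace (x + h - x) with h in Hc by ring.
    exact (Hc Hh). }
  split; eexists; exists r; intros h H1; apply (Hh h H1).
- intros H x. destruct (H x) as [[c [r Hc]] [d [q Hd]]].
  exists (fun n => (c n, d n)), (mkposreal (Rmin r q) (Rmin_stable_in_posreal r q)).
  intros y Hy. simpl in Hy. rewrite (surjective_pairing (f y)).
  replace (f y) with (f (x + (y - x))) by (f_equal; ring).
  apply is_pseries_C; [apply Hc | apply Hd];
  (eapply Rlt_le_trans; [exact Hy|]); [apply Rmin_l | apply Rmin_r].
Qed.

Lemma real_analytic_unique (f g : R -> C) (p q : R) :
  real_analytic f -> real_analytic g -> p < q ->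
  (forall x, p < x < q -> f x = g x) -> forall x, f x = g x.
Proof.
intros Hf Hg Hpq H x.
destruct (real_analytic_iff f) as [Hf' _]. specialize (Hf' Hf).
destruct (real_analytic_iff g) as [Hg' _]. specialize (Hg' Hg).
assert (E1 : fst (f x) + -1 * fst (g x) = 0).
{ revert x. apply (analytic_identity _ p q); [|exact Hpq|].
  - intros x. apply analytic_at_plus; [apply Hf'|]. apply analytic_at_mult; [apply analytic_at_const | apply Hg'].
  - intros x Hx. rewrite (H x Hx). ring. }
assert (E2 : snd (f x) + -1 * snd (g x) = 0).
{ clear E1. revert x. apply (analytic_identity _ p q); [|exact Hpq|].
  - intros x. apply analytic_at_plus; [apply Hf'|]. apply analytic_at_mult; [apply analytic_at_const | apply Hg'].
  - intros x Hx. rewrite (H x Hx). ring. }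
rewrite (surjective_pairing (f x)), (surjective_pairing (g x)). f_equal; lra.
Qed.

(** * Arguments and square roots *)

(** This is exp (i z): an angle theta = - i log Z satisfies Z = [iexp theta]. *)
Definition iexp (z : C) : C := (exp (- Im z) * cis (Re z))%C.

Lemma Cmod_cis (t : R) : Cmod (cis t) = 1.
Proof.
unfold Cmod, cis; cbn [fst snd]. rewrite <- sqrt_1. f_equal.
rewrite <- (sin2_cos2 t). unfold Rsqr. ring.
Qed.

Lemma cis_plus (s t : R) : cis (s + t) = (cis s * cis t)%C.
Proof.
unfold cis, Cmult; cbn [fst snd]. rewrite cos_plus, sin_plus. f_equal; ring.
Qed.

Lemma iexp_plus (z z' : C) : iexp (z + z') = (iexp z * iexp z')%C.
Proof.
unfold iexp. change (Im (z + z')) with (Im z + Im z'). change (Re (z + z')) with (Re z + Re z').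
rewrite cis_plus, Ropp_plus_distr, exp_plus, RtoC_mult. ring.
Qed.

Lemma iexp_0 : iexp 0 = 1%C.
Proof.
unfold iexp, cis. simpl. rewrite Ropp_0, exp_0, cos_0, sin_0.
unfold Cmult, RtoC; simpl. f_equal; ring.
Qed.

Lemma iexp_opp_l (z : C) : (iexp (- z) * iexp z)%C = 1%C.
Proof.
rewrite <- iexp_plus, Cplus_comm, Cplus_opp_r. apply iexp_0.
Qed.

Lemma iexp_neq_0 (z : C) : iexp z <> 0.
Proof.
intros H. assert (E := iexp_opp_l z). rewrite H, Cmult_0_r in E.
injection E; lra.
Qed.

Lemma iexp_opp (z : C) : iexp (- z) = (/ iexp z)%C.
Proof.
rewrite <- (Cmult_1_l (/ iexp z)), <- (iexp_opp_l z). field. apply iexp_neq_0.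
Qed.

Definition arg_in_range (s : pm) (t : R) : Prop :=
  match s with Upper => - PI < t <= PI | Lower => - PI <= t < PI end.

Lemma Cmod_scal_cis (r t : R) : 0 < r -> Cmod (r * cis t) = r.
Proof.
intros Hr. rewrite Cmod_mult, Cmod_cis, Cmod_R, Rabs_pos_eq; lra.
Qed.

Lemma arg_scal_cis (s : pm) (r t : R) : 0 < r -> arg_in_range s t ->
  arg s (r * cis t) = t.
Proof.
intros Hr Ht. unfold arg. rewrite Cmod_scal_cis by exact Hr.
assert (ER : Re (r * cis t) = r * cos t) by (unfold cis; simpl; ring).
assert (EI : Im (r * cis t) = r * sin t) by (unfold cis; simpl; ring).
rewrite ER, EI. replace (r * cos t / r) with (cos t) by (field; lra).
assert (Hpi := PI_RGT_0).
assert (A1 : 0 <= t <= PI -> acos (cos t) = t) by (apply acos_cos).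
assert (A2 : - PI <= t <= 0 -> acos (cos t) = - t).
{ intros H. rewrite <- cos_neg. apply acos_cos; lra. }
assert (S1 : 0 < t < PI -> 0 < r * sin t).
{ intros H. apply Rmult_lt_0_compat; [lra | apply sin_gt_0; lra]. }
assert (S2 : - PI < t < 0 -> r * sin t < 0).
{ intros H. assert (0 < r * sin (- t)); [|rewrite sin_neg in *; lra].
  apply Rmult_lt_0_compat; [lra | apply sin_gt_0; lra]. }
assert (S3 : t = 0 -> r * sin t = 0) by (intros ->; rewrite sin_0; ring).
assert (S4 : t = PI -> r * sin t = 0) by (intros ->; rewrite sin_PI; ring).
assert (S5 : t = - PI -> r * sin t = 0) by (intros ->; rewrite sin_neg, sin_PI; ring).
destruct s; simpl in Ht.
- destruct (Rle_dec 0 (r * sin t)) as [h|h].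
  + apply A1. destruct (Rlt_dec t 0); [|lra]. exfalso. lra.
  + rewrite A2; [ring|]. destruct (Rle_dec t 0); [lra|]. exfalso.
    destruct (Req_dec t PI); lra.
- destruct (Rlt_dec 0 (r * sin t)) as [h|h].
  + apply A1. destruct (Rlt_dec t 0); [|lra]. exfalso.
    destruct (Req_dec t (- PI)); lra.
  + rewrite A2; [ring|]. destruct (Rle_dec t 0); [lra|]. exfalso. lra.
Qed.

(** Reduces every choice of a branch of the logarithm to a bound on the real part of the angle. *)
Lemma clog_iexp (s : pm) (z : C) : arg_in_range s (Re z) ->
  (- Ci * clog s (iexp z))%C = z.
Proof.
intros Hz. unfold clog, iexp.
rewrite Cmod_scal_cis, arg_scal_cis, ln_exp; try apply exp_pos; [|exact Hz].
destruct z as [x y]. unfold Cmult, Copp, Ci; simpl. f_equal; ring.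
Qed.

(** Apart from 0, the condition says that the argument lies in (- PI / 2, PI / 2]; its double stays
    in (- PI, PI], so squaring causes no wrap-around. *)
Lemma Csqrt_sqr (z : C) : 0 < Re z \/ Re z = 0 /\ 0 <= Im z ->
  Csqrt (z * z) = z.
Proof.
intros Hz. destruct (Ceq_dec z 0) as [->|Hz0].
{ unfold Csqrt. rewrite Cmult_0_l, Cmod_0, sqrt_0. ring. }
assert (Hm : 0 < Cmod z) by (apply Cmod_gt_0, Hz0).
assert (Hp := clog_polar Upper z Hz0). assert (Hr := arg_range Upper z Hz0).
cbn beta iota in Hr. set (t := arg Upper z) in *. set (r := Cmod z) in *.
assert (ER : Re z = r * cos t) by (rewrite Hp; unfold cis; simpl; ring).
assert (EI : Im z = r * sin t) by (rewrite Hp; unfold cis; simpl; ring).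
assert (Hpi := PI_RGT_0).
assert (Hc : 0 <= cos t).
{ destruct (Rle_dec 0 (cos t)); [assumption|exfalso].
  assert (r * cos t < 0) by nra. lra. }
assert (Ht : - (PI / 2) < t <= PI / 2).
{ split.
  - destruct (Rlt_dec (- (PI / 2)) t); [assumption|exfalso].
    destruct (Req_dec t (- (PI / 2))) as [E|E].
    + rewrite E, cos_neg, cos_PI2 in ER. rewrite E, sin_neg, sin_PI2 in EI. lra.
    + assert (cos (- t) < 0) by (apply cos_lt_0; lra). rewrite cos_neg in *; lra.
  - destruct (Rle_dec t (PI / 2)); [assumption|exfalso].
    assert (cos t < 0) by (apply cos_lt_0; lra). lra. }
assert (E2 : (z * z)%C = (RtoC (r * r) * cis (2 * t))%C).
{ rewrite Hp at 1 2. replace (2 * t) with (t + t) by ring.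
  rewrite cis_plus, RtoC_mult. ring. }
assert (Hrr : 0 < r * r) by (apply Rmult_lt_0_compat; assumption).
unfold Csqrt. rewrite E2, Cmod_scal_cis, arg_scal_cis; try exact Hrr; [|simpl; lra].
rewrite sqrt_square by lra. rewrite Hp. f_equal. f_equal. field.
Qed.

(** * Complex polar coordinates *)

(* The function g of the header, with real and imaginary parts written so that
   the formula is the same in all quadrants. *)
Definition axis_angle (x : vec) (phi : R) : C :=
  (/ 2 * atan (2 * fst x * snd x * cos (phi / 2) / mdot x x),
   / 4 * (ln (edot x x + 2 * fst x * snd x * sin (phi / 2))
          - ln (edot x x - 2 * fst x * snd x * sin (phi / 2)))).

(** A convex combination of (x_0 + x_1)^2 and (x_0 - x_1)^2 with weights (1 + u) / 2 and (1 - u) /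
    2; both squares are positive exactly because x is not null. *)
Lemma edot_gt (x : vec) (u : R) : ~ null x -> -1 <= u <= 1 ->
  0 < edot x x + 2 * fst x * snd x * u.
Proof.
destruct x as [a b]; unfold null, mdot, edot; cbn [fst snd]; intros Hx Hu.
assert (H1 : 0 < (a - b) ^ 2).
{ rewrite <- Rsqr_pow2. apply Rlt_0_sqr. intros E. apply Hx. replace a with b by lra. ring. }
assert (H2 : 0 < (a + b) ^ 2).
{ rewrite <- Rsqr_pow2. apply Rlt_0_sqr. intros E. apply Hx. replace a with (- b) by lra. ring. }
replace (a * a + b * b + 2 * a * b * u) with
  ((1 + u) / 2 * (a + b) ^ 2 + (1 - u) / 2 * (a - b) ^ 2) by field.
destruct (Rlt_dec u 0); nra.
Qed.

Lemma edot_pm_sin_gt (x : vec) (t : R) : ~ null x ->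
  0 < edot x x + 2 * fst x * snd x * sin t /\
  0 < edot x x - 2 * fst x * snd x * sin t.
Proof.
intros Hx. assert (H := SIN_bound t). split; [apply edot_gt; assumption|].
replace (edot x x - 2 * fst x * snd x * sin t) with
  (edot x x + 2 * fst x * snd x * - sin t) by ring.
apply edot_gt; [assumption | lra].
Qed.

Ltac analytic := repeat match goal with
  | |- analytic_at (fun _ => ?k) _ => exact (analytic_at_const k _)
  | |- analytic_at (fun y => cos (?k * y)) _ => exact (analytic_at_cos k _)
  | |- analytic_at (fun y => sin (?k * y)) _ => exact (analytic_at_sin k _)
  | |- analytic_at (fun y => @?u y * @?v y) _ => apply (analytic_at_mult u v)
  | |- analytic_at (fun y => @?u y + @?v y) _ => apply (analytic_at_plus u v)
  | |- analytic_at (fun y => / @?u y) _ => apply (analytic_at_inv u)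
  end.

Lemma real_analytic_axis_angle (x : vec) : ~ null x -> real_analytic (axis_angle x).
Proof.
intros Hx. apply real_analytic_iff. intros p.
assert (H : forall t, 0 < edot x x + 2 * fst x * snd x * sin t /\
  0 < edot x x - 2 * fst x * snd x * sin t).
{ intros t. apply edot_pm_sin_gt, Hx. }
unfold axis_angle; cbn [fst snd].
set (k := 2 * fst x * snd x) in *. set (e := edot x x) in *.
set (m := / mdot x x).
split.
- apply (analytic_at_primitive _ (fun y => / 2 * (k * m * (- / 2 * sin (/ 2 * y))
     * / (1 + k * m * cos (/ 2 * y) * (k * m * cos (/ 2 * y)))))).
  + intros y. unfold Rdiv. fold m. auto_derive; [exact I|].
    replace (y * / 2) with (/ 2 * y) by ring. field.
    assert (0 <= Rsqr (k * m * cos (/ 2 * y))) by apply Rle_0_sqr.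
    unfold Rsqr in *; nra.
  + analytic.
    assert (0 <= Rsqr (k * m * cos (/ 2 * p))) by apply Rle_0_sqr.
    unfold Rsqr in *; lra.
- apply (analytic_at_primitive _ (fun y => / 4 * (k * (/ 2 * cos (/ 2 * y)) * / (e + k * sin (/ 2 * y))
     + k * (/ 2 * cos (/ 2 * y)) * / (e + -1 * (k * sin (/ 2 * y)))))).
  + intros y. specialize (H (/ 2 * y)). unfold Rdiv. auto_derive;
    replace (y * / 2) with (/ 2 * y) by ring; [lra|]. field. lra.
  + specialize (H (/ 2 * p)).
    analytic; lra.
Qed.

Lemma axis_angle_opp (x : vec) (phi : R) :
  axis_angle x (- phi) = Cconj (axis_angle x phi).
Proof.
unfold axis_angle, Cconj; cbn [fst snd].
replace (- phi / 2) with (- (phi / 2)) by field. rewrite cos_neg, sin_neg.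
f_equal. replace (edot x x + 2 * fst x * snd x * - sin (phi / 2)) with
  (edot x x - 2 * fst x * snd x * sin (phi / 2)) by ring.
replace (edot x x - 2 * fst x * snd x * - sin (phi / 2)) with
  (edot x x + 2 * fst x * snd x * sin (phi / 2)) by ring. ring.
Qed.

Lemma axis_angle_shift (x : vec) (phi : R) :
  axis_angle x (phi + 2 * PI) = (- axis_angle x phi)%C.
Proof.
unfold axis_angle, Copp; cbn [fst snd].
replace ((phi + 2 * PI) / 2) with (phi / 2 + PI) by field. rewrite neg_cos, neg_sin.
f_equal.
- replace (2 * fst x * snd x * - cos (phi / 2) / mdot x x) with
    (- (2 * fst x * snd x * cos (phi / 2) / mdot x x)) by (unfold Rdiv; ring).
  rewrite atan_opp. ring.
- replace (edot x x + 2 * fst x * snd x * - sin (phi / 2)) with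
    (edot x x - 2 * fst x * snd x * sin (phi / 2)) by ring.
  replace (edot x x - 2 * fst x * snd x * - sin (phi / 2)) with
    (edot x x + 2 * fst x * snd x * sin (phi / 2)) by ring. ring.
Qed.

Lemma axis_angle_Re_bound (x : vec) (phi : R) :
  - (PI / 4) < Re (axis_angle x phi) < PI / 4.
Proof.
unfold axis_angle, Re; cbn [fst].
assert (H := atan_bound (2 * fst x * snd x * cos (phi / 2) / mdot x x)). lra.
Qed.

(** The value exp (i p) for the axis angle p of the quadrant; angles are measured from the x_1 axis
    towards the x_0 axis. *)
Definition axis_dir (x : vec) : C :=
  match quadrant_of x with QI => 1 | QII => Ci | QIII => -1 | QIV => - Ci end.

Lemma axis_dir_sqr (x : vec) : ~ null x ->
  (axis_dir x * axis_dir x)%C = RtoC (mdot x x / Rabs (mdot x x)).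
Proof.
intros Hx. unfold axis_dir. assert (Hq := proj1 (quadrant_ofP x _ Hx) eq_refl).
destruct x as [a b]. unfold null, mdot in *. cbn [fst snd] in *.
assert (E : forall M, M <> 0 -> M / Rabs M = if Rlt_dec 0 M then 1 else -1).
{ intros M HM. destruct (Rlt_dec 0 M); [rewrite Rabs_pos_eq | rewrite Rabs_left]; try lra; field; lra. }
rewrite E by exact Hx.
destruct (quadrant_of (a, b)); simpl in Hq;
destruct (Rlt_dec 0 (- (a * a) + b * b)) as [h|h];
try (exfalso; unfold Rabs in Hq; destruct (Rcase_abs a), (Rcase_abs b); nra);
unfold Cmult, Copp, Ci, RtoC; simpl; f_equal; ring.
Qed.

(** Put F = x_1 - i w x_0 and G = x_1 + i w x_0. Then [A] is |F|^2 and [(mdot x x, P)] is G times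
    the conjugate of F, so this is exp (2 i g) = G / F up to the sign of [mdot x x], cleared of
    denominators. *)
Lemma iexp_axis_angle_sqr (x : vec) (phi : R) : ~ null x ->
  let A := edot x x + 2 * fst x * snd x * sin (phi / 2) in
  let P := 2 * fst x * snd x * cos (phi / 2) in
  let E := iexp (axis_angle x phi) in
  (E * E * A * Rabs (mdot x x))%C = ((mdot x x, P) * mdot x x)%C.
Proof.
intros Hx A P E. destruct (edot_pm_sin_gt x (phi / 2) Hx) as [HA HB]. fold A in HA.
set (B := edot x x - 2 * fst x * snd x * sin (phi / 2)) in *.
set (M := mdot x x).
assert (HM : M <> 0) by exact Hx.
(* Both sides are |F|^2 |G|^2, since [B] is |G|^2. *)
assert (HAB : A * B = M * M + P * P).
{ unfold A, B, M, P, mdot, edot. assert (H := sin2_cos2 (phi / 2)). unfold Rsqr in H.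
  set (c := cos (phi / 2)) in *. set (s := sin (phi / 2)) in *.
  replace (s * s) with (1 - c * c) by lra. nra. }
assert (HM2 : 0 < Rabs M) by (apply Rabs_pos_lt, HM).
assert (HAB0 : 0 < A * B) by (apply Rmult_lt_0_compat; assumption).
set (r := sqrt (A * B)). assert (Hr : 0 < r) by (apply sqrt_lt_R0; assumption).
assert (Hrr : r * r = A * B) by (apply sqrt_sqrt; lra).
assert (Hy : sqrt (1 + (P / M)²) = r / Rabs M).
{ rewrite <- sqrt_Rsqr_abs. unfold r. rewrite <- sqrt_div_alt by (apply Rsqr_pos_lt; exact HM).
  f_equal. rewrite HAB. unfold Rsqr. field. exact HM. }
assert (EE : (E * E)%C = (RtoC (r / A) * cis (atan (P / M)))%C).
{ unfold E. rewrite <- iexp_plus. unfold iexp. f_equal.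
  - f_equal. apply (Rmult_eq_reg_r A); [|lra]. replace (r / A * A) with r by (field; lra).
    apply Rsqr_inj; [|lra|].
    + apply Rmult_le_pos; [left; apply exp_pos | lra].
    + unfold Rsqr. rewrite Hrr. unfold axis_angle; simpl. fold A B.
      match goal with |- exp ?u * A * (exp ?u * A) = _ =>
        replace (exp u * A * (exp u * A)) with (exp (u + u) * A * A) by (rewrite exp_plus; ring);
        replace (u + u) with (ln B + - ln A) by field end.
      rewrite exp_plus, exp_Ropp, !exp_ln by assumption. field. lra.
  - f_equal. unfold axis_angle; simpl. fold P M. field. }
rewrite EE. unfold cis. rewrite cos_atan, sin_atan, Hy.
assert (HMM : Rabs M * Rabs M = M * M).
{ rewrite <- Rabs_mult. apply Rabs_pos_eq. apply Rle_0_sqr. }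
unfold Cmult, RtoC; simpl. f_equal.
- transitivity (Rabs M * Rabs M); [field; repeat split; lra | rewrite HMM; ring].
- transitivity (P / M * (Rabs M * Rabs M)); [field; repeat split; lra | rewrite HMM; field; lra].
Qed.

(** By the imaginary part of [iexp_axis_angle_sqr], the factor in front of [sin t] is a positive
    multiple of [cos t * sin t]. The sign of [sin t] decides the square root in [Csqrt_star]. *)
Lemma axis_angle_sin_sign (x : vec) (phi : R) : ~ null x ->
  let t := Re (axis_angle x phi) in
  0 < cos t /\ 0 <= fst x * snd x * cos (phi / 2) * mdot x x * sin t.
Proof.
intros Hx t.
assert (Ht := axis_angle_Re_bound x phi). fold t in Ht. assert (Hpi := PI_RGT_0).
assert (Hc : 0 < cos t) by (apply cos_gt_0; lra).
split; [exact Hc|].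
assert (H := iexp_axis_angle_sqr x phi Hx). cbv zeta in H.
destruct (edot_pm_sin_gt x (phi / 2) Hx) as [HA _].
set (A := edot x x + 2 * fst x * snd x * sin (phi / 2)) in *.
set (M := mdot x x) in *.
assert (HM2 : 0 < Rabs M) by (apply Rabs_pos_lt, Hx).
unfold iexp in H. fold t in H. set (e := exp _) in H.
assert (He : 0 < e) by apply exp_pos.
apply (f_equal snd) in H. unfold cis, Cmult, RtoC in H. simpl in H.
assert (E : fst x * snd x * cos (phi / 2) * M * sin t =
  e * e * cos t * A * Rabs M * (sin t * sin t)).
{ apply (Rmult_eq_reg_l 2); [|lra].
  replace (2 * (fst x * snd x * cos (phi / 2) * M * sin t)) with
   ((2 * fst x * snd x * cos (phi / 2) * M) * sin t) by ring.
  replace (2 * fst x * snd x * cos (phi / 2) * M) with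
    (M * 0 + 2 * fst x * snd x * cos (phi / 2) * M) by ring.
  rewrite <- H. ring. }
rewrite E. assert (0 <= sin t * sin t) by apply Rle_0_sqr.
apply Rmult_le_pos; [repeat apply Rmult_le_pos; lra | assumption].
Qed.

(** [U] is exp (i gamma), and the equation results from eliminating S between the two polar
    equations; S itself is then [F * U]. *)
Lemma polar_factors (x : vec) (phi : R) : ~ null x ->
  let F := (snd x - Ci * cis (phi / 2) * fst x)%C in
  let U := (axis_dir x * iexp (axis_angle x phi))%C in
  F <> 0 /\ (F * U * U)%C = (snd x + Ci * cis (phi / 2) * fst x)%C.
Proof.
intros Hx F U.
assert (H := iexp_axis_angle_sqr x phi Hx). cbv zeta in H.
destruct (edot_pm_sin_gt x (phi / 2) Hx) as [HA _].
set (A := edot x x + 2 * fst x * snd x * sin (phi / 2)) in *.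
set (P := 2 * fst x * snd x * cos (phi / 2)) in *.
set (M := mdot x x) in *.
assert (HM2 : 0 < Rabs M) by (apply Rabs_pos_lt, Hx).
assert (HF : (F * Cconj F)%C = A).
{ unfold F, Cconj, A, edot, cis, Ci, Cmult, Cminus, Cplus, Copp, RtoC; simpl.
  assert (Ht := sin2_cos2 (phi / 2)). unfold Rsqr in Ht.
  f_equal; [|ring].
  replace (fst x * fst x) with (fst x * fst x * (sin (phi / 2) * sin (phi / 2) +
     cos (phi / 2) * cos (phi / 2))) by (rewrite Ht; ring). ring. }
assert (HF2 : ((snd x + Ci * cis (phi / 2) * fst x) * Cconj F)%C = (M, P)).
{ unfold F, Cconj, M, P, mdot, cis, Ci, Cmult, Cminus, Cplus, Copp, RtoC; simpl.
  assert (Ht := sin2_cos2 (phi / 2)). unfold Rsqr in Ht.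
  f_equal; [|ring].
  replace (fst x * fst x) with (fst x * fst x * (sin (phi / 2) * sin (phi / 2) +
     cos (phi / 2) * cos (phi / 2))) by (rewrite Ht; ring). ring. }
assert (HA0 : RtoC A <> 0) by (intros E; injection E; lra).
assert (HM0 : RtoC (Rabs M) <> 0) by (intros E; injection E; lra).
assert (HMM : (RtoC M * RtoC M)%C = (RtoC (Rabs M) * RtoC (Rabs M))%C).
{ rewrite <- !RtoC_mult, <- Rabs_mult. f_equal. symmetry. apply Rabs_pos_eq, Rle_0_sqr. }
split.
- intros E. rewrite E, Cmult_0_l in HF. apply HA0. symmetry; exact HF.
- unfold U. set (E := iexp (axis_angle x phi)) in *.
  transitivity (F * (axis_dir x * axis_dir x) * (E * E))%C; [ring|].
  rewrite axis_dir_sqr by exact Hx. fold M.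
  rewrite RtoC_div by lra.
  set (G := (snd x + Ci * cis (phi / 2) * fst x)%C) in *.
  transitivity (F * M * (E * E * A * Rabs M) / (A * (Rabs M * Rabs M)))%C.
  { field. split; assumption. }
  rewrite H, <- HF2.
  transitivity (G * (F * Cconj F) * (M * M) / (A * (Rabs M * Rabs M)))%C.
  { field. split; assumption. }
  rewrite HF, HMM. field. split; assumption.
Qed.

(* Picks out the principal square root S = p + i q of x star x for a time-like x:
   the real part of exp (- i phi / 2) S is positive, and S^2 has the imaginary
   part of x_0^2 exp (i phi). *)
Lemma sqrt_branch (p q c s k : R) : k <> 0 -> 0 <= c -> c * c + s * s = 1 ->
  (c = 0 -> 0 < s) -> 0 < p * c + q * s -> p * q = k * k * (s * c) ->
  0 < p \/ p = 0 /\ 0 <= q.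
Proof.
intros Hk Hc H1 Hs Hu Hp.
destruct (Req_dec c 0) as [E|E].
- specialize (Hs E). subst c. assert (s = 1) by nra. subst s.
  assert (0 < q) by lra. right. split; [|lra].
  assert (HH : p * q = 0) by (rewrite Hp; ring).
  apply Rmult_integral in HH. lra.
- left. destruct (Rlt_dec 0 p); [assumption|exfalso].
  assert (Hqs : 0 < q * s) by nra.
  assert (Hs0 : s <> 0) by (intros ->; lra).
  assert (0 < k * k) by (apply Rsqr_pos_lt; exact Hk).
  assert (0 < s * s) by (apply Rsqr_pos_lt; exact Hs0).
  assert (0 < k * k * (s * s) * c).
  { apply Rmult_lt_0_compat; [apply Rmult_lt_0_compat|]; lra. }
  assert (p * (q * s) = k * k * (s * s) * c) by (rewrite <- Rmult_assoc, Hp; ring).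
  assert (0 <= - p * (q * s)) by (apply Rmult_le_pos; lra).
  lra.
Qed.

Lemma big_part_gt_0 (y z s cg w : R) : Rabs y < z -> -1 <= s <= 1 -> 0 < cg -> 0 <= w ->
  0 < (z + y * s) * cg + w.
Proof.
intros Hz Hs Hg Hw. assert (0 < z + y * s).
{ unfold Rabs in Hz; destruct (Rcase_abs y); nra. }
assert (0 < (z + y * s) * cg) by (apply Rmult_lt_0_compat; assumption). lra.
Qed.

(** The right side squares to (x_1 - i w x_0) (x_1 + i w x_0) by [polar_factors]; it remains to see
    that it is the principal root. For space-like x its real part is a dominant term times cos g
    plus a term that [axis_angle_sin_sign] makes non-negative. For time-like x this holds after
    multiplication by exp (- i phi / 2), and [sqrt_branch] rotates back. *)
Lemma Csqrt_star (x : vec) (phi : R) : ~ null x -> - PI < phi <= PI ->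
  Csqrt (star phi x x) = ((snd x - Ci * cis (phi / 2) * fst x)
     * (axis_dir x * iexp (axis_angle x phi)))%C.
Proof.
intros Hx Hphi.
destruct (polar_factors x phi Hx) as [_ HU]. cbv zeta in HU.
destruct (axis_angle_sin_sign x phi Hx) as [Hc Hs]. cbv zeta in Hs.
set (U := (axis_dir x * iexp (axis_angle x phi))%C) in *.
set (S := ((snd x - Ci * cis (phi / 2) * fst x) * U)%C).
assert (HS : (S * S)%C = star phi x x).
{ unfold S. transitivity ((snd x - Ci * cis (phi / 2) * fst x) *
    ((snd x - Ci * cis (phi / 2) * fst x) * U * U))%C; [ring|].
  rewrite HU. unfold star. replace phi with (phi / 2 + phi / 2) at 3 by field.
  rewrite cis_plus, !RtoC_mult. unfold Ci. 
  unfold Cmult, Cplus, Cminus, Copp, RtoC, cis; simpl. f_equal; ring. }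
rewrite <- HS. apply Csqrt_sqr.
assert (Hpi := PI_RGT_0).
assert (Hct : 0 <= cos (phi / 2)) by (apply cos_ge_0; lra).
assert (HctS : phi <> PI -> 0 < cos (phi / 2)) by (intros; apply cos_gt_0; lra).
assert (HI := f_equal Im HS).
assert (Hq := proj1 (quadrant_ofP x _ Hx) eq_refl).
unfold S, U, axis_dir, iexp in *.
set (e := exp _) in *. assert (He : 0 < e) by apply exp_pos.
set (g := Re (axis_angle x phi)) in *.
clear HU HS.
assert (Hsc := sin2_cos2 (phi / 2)). unfold Rsqr in Hsc.
assert (Hsb := SIN_bound (phi / 2)).
assert (Hs1 : cos (phi / 2) = 0 -> 0 < sin (phi / 2)).
{ intros E. destruct (Req_dec phi PI) as [->|Hne]; [rewrite sin_PI2; lra|].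
  specialize (HctS Hne). lra. }
clearbody e g. clear HctS Hphi Hpi.
set (c := cos (phi / 2)) in *. set (s := sin (phi / 2)) in *.
set (cg := cos g) in *. set (sg := sin g) in *.
destruct x as [x0 x1]. unfold null, mdot in *. cbn [fst snd] in *.
assert (Hk : quadrant_of (x0, x1) = QII \/ quadrant_of (x0, x1) = QIV ->
  Im (star phi (x0, x1) (x0, x1)) = 2 * (x0 * x0 * (s * c))).
{ intros _. unfold star. replace phi with (phi / 2 + phi / 2) by field.
  rewrite cis_plus. unfold cis, Cmult, Cplus, RtoC, Im; cbn [fst snd]. fold c s. ring. }
destruct (quadrant_of (x0, x1)); simpl in Hq.
- left. match goal with |- _ < Re ?z => replace (Re z) with (e * ((x1 + x0 * s) * cg + x0 * c * sg)) by
    (unfold cis; cbn; fold c s cg sg; ring) end.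
  apply Rmult_lt_0_compat; [exact He|]. apply big_part_gt_0; try lra.
  apply (Rmult_le_reg_r (x1 * (- (x0 * x0) + x1 * x1))); [|lra].
  apply Rmult_lt_0_compat; unfold Rabs in Hq; destruct (Rcase_abs x0); nra.
- apply (sqrt_branch _ _ c s x0); try assumption; try lra.
  + intros ->. assert (H0 := Rabs_pos x1). lra.
  + match goal with |- _ < Re ?z * _ + Im _ * _ => replace (Re z * c + Im z * s) with
      (e * ((x0 * (s * s + c * c) + x1 * s) * cg + x1 * c * - sg)) by
      (unfold cis; cbn; fold c s cg sg; ring) end.
    rewrite Hsc, Rmult_1_r.
    apply Rmult_lt_0_compat; [exact He|]. apply big_part_gt_0; try lra.
    apply (Rmult_le_reg_r (x0 * (x0 * x0 - x1 * x1))); [|lra].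
    apply Rmult_lt_0_compat; unfold Rabs in Hq; destruct (Rcase_abs x1); nra.
  + rewrite (Hk (or_introl eq_refl)) in HI.
    match type of HI with Im (?z * _) = _ =>
      change (Im (z * z)) with (Re z * Im z + Im z * Re z) in HI end. lra.
- left. match goal with |- _ < Re ?z => replace (Re z) with (e * ((- x1 + - x0 * s) * cg + - x0 * c * sg)) by
    (unfold cis; cbn; fold c s cg sg; ring) end.
  apply Rmult_lt_0_compat; [exact He|]. apply big_part_gt_0; rewrite ?Rabs_Ropp; try lra.
  apply (Rmult_le_reg_r (- x1 * (- (x0 * x0) + x1 * x1))); [|lra].
  apply Rmult_lt_0_compat; unfold Rabs in Hq; destruct (Rcase_abs x0); nra.
- apply (sqrt_branch _ _ c s x0); try assumption; try lra.
  + intros ->. assert (H0 := Rabs_pos x1). lra.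
  + match goal with |- _ < Re ?z * _ + Im _ * _ => replace (Re z * c + Im z * s) with
      (e * ((- x0 * (s * s + c * c) + - x1 * s) * cg + x1 * c * sg)) by
      (unfold cis; cbn; fold c s cg sg; ring) end.
    rewrite Hsc, Rmult_1_r.
    apply Rmult_lt_0_compat; [exact He|]. apply big_part_gt_0; rewrite ?Rabs_Ropp; try lra.
    apply (Rmult_le_reg_r (- x0 * (x0 * x0 - x1 * x1))); [|lra].
    apply Rmult_lt_0_compat; unfold Rabs in Hq; destruct (Rcase_abs x1); nra.
  + rewrite (Hk (or_intror eq_refl)) in HI.
    match type of HI with Im (?z * _) = _ =>
      change (Im (z * z)) with (Re z * Im z + Im z * Re z) in HI end. lra.
Qed.

(** * Counting light rays *)

(** The non-negative solutions of the first equation form the ray through [(p' * p', - (p * p'))],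
    where the second left side equals [p' * (q * p' - p * q')]; only the sign of this value has to
    match that of [k]. *)
Lemma cone_contains_axis (p q p' q' k : R) : k <> 0 -> p * p' < 0 ->
  ((exists s t, 0 <= s /\ 0 <= t /\ s * p + t * p' = 0 /\ s * q + t * q' = k)
   <-> 0 < k * (p' * (q * p' - p * q'))).
Proof.
intros Hk Hp.
assert (Hp0 : p <> 0) by (intros ->; lra).
assert (Hp1 : p' <> 0) by (intros ->; lra).
assert (Hpp : 0 < p' * p') by (apply Rsqr_pos_lt; exact Hp1).
split.
- intros [s [t [Hs [Ht [E1 E2]]]]].
  assert (E3 : p' * (p' * k) = s * (p' * (q * p' - p * q'))).
  { rewrite <- E2. replace (p' * (p' * (s * q + t * q'))) with
      (p' * (s * q * p' + (t * p') * q')) by ring.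
    replace (t * p') with (- (s * p)) by lra. ring. }
  set (W := p' * (q * p' - p * q')) in *.
  assert (E4 : s * (k * W) = k * k * (p' * p')).
  { replace (s * (k * W)) with (k * (s * W)) by ring. rewrite <- E3. ring. }
  assert (0 < k * k * (p' * p')).
  { apply Rmult_lt_0_compat; [apply Rsqr_pos_lt|]; assumption. }
  destruct (Rlt_dec 0 (k * W)); [assumption|exfalso].
  assert (0 <= s * - (k * W)) by (apply Rmult_le_pos; lra). lra.
- intros HW. set (W := p' * (q * p' - p * q')) in *.
  assert (HW0 : q * p' - p * q' <> 0).
  { intros E. unfold W in HW. rewrite E in HW. lra. }
  exists (k * W * (p' * p') / (W * W)), (k * W * - (p * p') / (W * W)).
  assert (HWW : 0 < W * W).
  { apply Rsqr_pos_lt. intros E. rewrite E in HW. lra. }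
  assert (Hi : 0 < / (W * W)) by (apply Rinv_0_lt_compat, HWW).
  split; [|split; [|split]].
  + apply Rmult_le_pos; [|lra]. apply Rmult_le_pos; lra.
  + apply Rmult_le_pos; [|lra]. apply Rmult_le_pos; lra.
  + unfold Rdiv; ring.
  + unfold W. field. split; assumption.
Qed.

Lemma cone_avoids_axis (p q p' q' k : R) : k <> 0 -> 0 < p * p' ->
  ~ (exists s t, 0 <= s /\ 0 <= t /\ s * p + t * p' = 0 /\ s * q + t * q' = k).
Proof.
intros Hk Hp [s [t [Hs [Ht [E1 E2]]]]].
assert (Hp0 : 0 < p * p) by (apply Rsqr_pos_lt; intros ->; lra).
assert (E : s * (p * p) + t * (p * p') = 0).
{ replace (s * (p * p) + t * (p * p')) with (p * (s * p + t * p')) by ring. rewrite E1; ring. }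
assert (0 <= s * (p * p)) by (apply Rmult_le_pos; lra).
assert (0 <= t * (p * p')) by (apply Rmult_le_pos; lra).
assert (s = 0) by (apply (Rmult_eq_reg_r (p * p)); lra).
assert (t = 0) by (apply (Rmult_eq_reg_r (p * p')); lra).
subst. lra.
Qed.

Lemma light_ray_in_wedge_iff (a b d : vec) :
  light_ray_in_wedge a b d <-> exists s t : R, 0 <= s /\ 0 <= t /\
    s * fst a + t * fst b = fst d /\ s * snd a + t * snd b = snd d.
Proof.
unfold light_ray_in_wedge, half_line, wedge, vadd, vscal. split.
- intros H. destruct (H d) as [s [t [Hs [Ht E]]]].
  { exists 1. split; [lra|]. rewrite (surjective_pairing d); simpl. f_equal; ring. }
  exists s, t. rewrite E. cbn [fst snd]. auto.
- intros [s [t [Hs [Ht [E1 E2]]]]] x [r [Hr ->]].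
  exists (r * s), (r * t). split; [|split]; [apply Rmult_le_pos; assumption..|].
  rewrite <- E1, <- E2. cbn [fst snd]. f_equal; ring.
Qed.

(** Meant for the values of one null coordinate, x_1 - x_0 or x_1 + x_0, at the two vectors: a sign
    change means that the wedge meets the corresponding null line. *)
Definition crossings (p q : R) : nat := if Rlt_dec (p * q) 0 then 1 else 0.

(** Each null line carries two light rays. The wedge contains exactly one of them if a and b lie on
    opposite sides of the line and are not antiparallel, and none if they lie on the same side.
    Antiparallel vectors are separated by both lines, in accordance with the convention 2. *)
Lemma N_c_crossings (a b : vec) : ~ null a -> ~ null b ->
  N_c a b = (crossings (snd a - fst a) (snd b - fst b)
             + crossings (snd a + fst a) (snd b + fst b))%nat.
Proof.
destruct a as [a0 a1], b as [b0 b1]. unfold null, mdot; cbn [fst snd]. intros Ha Hb.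
assert (Ha1 : a1 - a0 <> 0) by (intros E; apply Ha; replace a1 with a0 by lra; ring).
assert (Ha2 : a1 + a0 <> 0) by (intros E; apply Ha; replace a1 with (- a0) by lra; ring).
assert (Hb1 : b1 - b0 <> 0) by (intros E; apply Hb; replace b1 with b0 by lra; ring).
assert (Hb2 : b1 + b0 <> 0) by (intros E; apply Hb; replace b1 with (- b0) by lra; ring).
clear Ha Hb.
assert (Hu : (a1 - a0) * (b1 - b0) <> 0) by (apply Rmult_integral_contrapositive; split; assumption).
assert (Hv : (a1 + a0) * (b1 + b0) <> 0) by (apply Rmult_integral_contrapositive; split; assumption).
unfold N_c, crossings. destruct (excluded_middle_informative _) as [HA|HA].
- destruct HA as [t [Ht E]]. unfold vscal in E; cbn [fst snd] in E.
  injection E; intros -> ->.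
  assert (0 < (a1 - a0) * (a1 - a0)) by (apply Rsqr_pos_lt; assumption).
  assert (0 < (a1 + a0) * (a1 + a0)) by (apply Rsqr_pos_lt; assumption).
  destruct (Rlt_dec _ _) as [h|h]; [destruct (Rlt_dec _ _) as [h'|h']; [reflexivity|]|]; exfalso; nra.
- assert (Hd : forall s, s < 0 -> b0 = s * a0 -> b1 = s * a1 -> False).
  { intros s Hs -> ->. apply HA. exists s. split; [exact Hs|reflexivity]. }
  (* The system is rewritten in null coordinates, in which the direction [(k, k)] reads
     [(0, 2 * k)]. *)
  assert (L : forall k : R, k <> 0 ->
    (light_ray_in_wedge (a0, a1) (b0, b1) (k, k) <->
     exists s t, 0 <= s /\ 0 <= t /\ s * (a1 - a0) + t * (b1 - b0) = 0 /\
       s * (a1 + a0) + t * (b1 + b0) = 2 * k)).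
  { intros k Hk. rewrite light_ray_in_wedge_iff. cbn [fst snd].
    split; intros [s [t H]]; exists s, t; repeat split; try apply H; lra. }
  assert (L' : forall k : R, k <> 0 ->
    (light_ray_in_wedge (a0, a1) (b0, b1) (- k, k) <->
     exists s t, 0 <= s /\ 0 <= t /\ s * (a1 + a0) + t * (b1 + b0) = 0 /\
       s * (a1 - a0) + t * (b1 - b0) = 2 * k)).
  { intros k Hk. rewrite light_ray_in_wedge_iff. cbn [fst snd].
    split; intros [s [t H]]; exists s, t; repeat split; try apply H; lra. }
  assert (P1 := L 1 ltac:(lra)). assert (P2 := L (-1) ltac:(lra)).
  assert (P3 := L' 1 ltac:(lra)). assert (P4 := L' (-1) ltac:(lra)).
  replace (- -1) with 1 in P4 by ring. clear L L'.
  (* If the determinant vanished, b would be [p' / p] times a, a negative multiple. *)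
  assert (N : forall p q p' q', p * p' < 0 ->
     (p = a1 - a0 /\ q = a1 + a0 /\ p' = b1 - b0 /\ q' = b1 + b0 \/
      q = a1 - a0 /\ p = a1 + a0 /\ q' = b1 - b0 /\ p' = b1 + b0) ->
      p' * (q * p' - p * q') <> 0).
  { intros p q p' q' Hp Hq E. apply Rmult_integral in E. destruct E as [E|E]; [subst; lra|].
    assert (Hp0 : p <> 0) by (intros ->; lra).
    assert (E1 : q' = p' / p * q) by (apply (Rmult_eq_reg_l p); [|exact Hp0]; field_simplify; lra).
    assert (E2 : p' = p' / p * p) by (field; exact Hp0).
    apply (Hd (p' / p)).
    - assert (0 < p * p) by (apply Rsqr_pos_lt, Hp0).
      apply (Rmult_lt_reg_r (p * p)); [assumption|]. field_simplify; lra.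
    - destruct Hq as [[? [? [? ?]]]|[? [? [? ?]]]]; subst; lra.
    - destruct Hq as [[? [? [? ?]]]|[? [? [? ?]]]]; subst; lra. }
  assert (C : forall p q p' q', p * p' <> 0 ->
     (p = a1 - a0 /\ q = a1 + a0 /\ p' = b1 - b0 /\ q' = b1 + b0 \/
      q = a1 - a0 /\ p = a1 + a0 /\ q' = b1 - b0 /\ p' = b1 + b0) ->
      let Q k := exists s t, 0 <= s /\ 0 <= t /\ s * p + t * p' = 0 /\ s * q + t * q' = 2 * k in
      (p * p' < 0 /\ (Q 1 /\ ~ Q (-1) \/ ~ Q 1 /\ Q (-1))) \/
      (~ (p * p' < 0) /\ ~ Q 1 /\ ~ Q (-1))).
  { intros p q p' q' Hp Hq Q. destruct (Rlt_dec (p * p') 0) as [h|h].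
    - left. split; [exact h|]. assert (HN := N p q p' q' h Hq).
      unfold Q. rewrite !cone_contains_axis by lra. lra.
    - right. split; [exact h|]. split; apply cone_avoids_axis; lra. }
  destruct (C _ _ _ _ Hu (or_introl (conj eq_refl (conj eq_refl (conj eq_refl eq_refl))))) as [[h1 C1]|[h1 C1]];
  destruct (C _ _ _ _ Hv (or_intror (conj eq_refl (conj eq_refl (conj eq_refl eq_refl))))) as [[h2 C2]|[h2 C2]];
  rewrite <- P1, <- P2 in C1; rewrite <- P3, <- P4 in C2; clear P1 P2 P3 P4 N C Hd;
  destruct (Rlt_dec ((a1 - a0) * (b1 - b0)) 0); try contradiction;
  destruct (Rlt_dec ((a1 + a0) * (b1 + b0)) 0); try contradiction;
  simpl; repeat (destruct (excluded_middle_informative _)); simpl; try reflexivity; exfalso; tauto.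
Qed.

(** * The continued angles *)

Definition det (a b : vec) : R := fst a * snd b - snd a * fst b.

(** The value 1 at determinant 0 keeps the square equal to 1 in all cases. *)
Definition orient (a b : vec) : R := if Rle_dec 0 (det a b) then 1 else -1.

Lemma area_orient (a b : vec) : 2 * area a b = orient a b * det a b.
Proof.
unfold area, orient, Rabs. fold (det a b).
destruct (Rle_dec 0 (det a b)), (Rcase_abs (det a b)); lra.
Qed.

Lemma N_c_sym (a b : vec) : ~ null a -> ~ null b -> N_c a b = N_c b a.
Proof.
intros Ha Hb. rewrite !N_c_crossings by assumption. unfold crossings.
rewrite (Rmult_comm (snd a - _)), (Rmult_comm (snd a + _)). reflexivity.
Qed.

Lemma quadrant_signs (x : vec) : ~ null x ->
  match quadrant_of x with
  | QI => 0 < snd x - fst x /\ 0 < snd x + fst x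
  | QII => snd x - fst x < 0 /\ 0 < snd x + fst x
  | QIII => snd x - fst x < 0 /\ snd x + fst x < 0
  | QIV => 0 < snd x - fst x /\ snd x + fst x < 0
  end.
Proof.
intros Hx. assert (Hq := proj1 (quadrant_ofP x _ Hx) eq_refl).
destruct (quadrant_of x); simpl in Hq; unfold Rabs in Hq;
[destruct (Rcase_abs (fst x)) | destruct (Rcase_abs (snd x))
|destruct (Rcase_abs (fst x)) | destruct (Rcase_abs (snd x))]; lra.
Qed.

Lemma crossings_same_sign (p q : R) : 0 < p /\ 0 < q \/ p < 0 /\ q < 0 -> crossings p q = 0%nat.
Proof. intros H. unfold crossings. destruct (Rlt_dec (p * q) 0); [exfalso; nra | reflexivity]. Qed.

Lemma crossings_opposite_sign (p q : R) : p < 0 < q \/ q < 0 < p -> crossings p q = 1%nat.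
Proof. intros H. unfold crossings. destruct (Rlt_dec (p * q) 0); [reflexivity | exfalso; nra]. Qed.

Lemma N_c_quadrant (a b : vec) : ~ null a -> ~ null b ->
  N_c a b = match quadrant_of a, quadrant_of b with
    | QI, QI | QII, QII | QIII, QIII | QIV, QIV => 0%nat
    | QI, QIII | QIII, QI | QII, QIV | QIV, QII => 2%nat
    | _, _ => 1%nat
    end.
Proof.
intros Ha Hb. rewrite N_c_crossings by assumption.
assert (Sa := quadrant_signs a Ha). assert (Sb := quadrant_signs b Hb).
destruct (quadrant_of a), (quadrant_of b);
repeat first [rewrite crossings_same_sign by lra | rewrite crossings_opposite_sign by lra]; reflexivity.
Qed.

Lemma cis_N_c (n : nat) : (n <= 2)%nat ->
  cis (- (PI * INR n / 2)) = match n with O => 1%C | 1%nat => (- Ci)%C | _ => (-1)%C end.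
Proof.
intros Hn. destruct n as [|[|[|n]]]; [| | |lia]; unfold cis; simpl INR.
- replace (- (PI * 0 / 2)) with 0 by field. rewrite cos_0, sin_0. reflexivity.
- replace (PI * 1 / 2) with (PI / 2) by field. rewrite cos_neg, sin_neg, cos_PI2, sin_PI2.
  unfold Ci, Copp; simpl. f_equal; ring.
- replace (PI * (1 + 1) / 2) with PI by field. rewrite cos_neg, sin_neg, cos_PI, sin_PI.
  unfold RtoC. f_equal; ring.
Qed.

(** A non-negative determinant means that the angle decreases from a to b across the wedge, and each
    light ray crossed turns the axis by - PI / 2. [HD2] is twice the determinant in null
    coordinates; it excludes neighbouring quadrants in the wrong order. *)
Lemma axis_dir_turn (a b : vec) : ~ null a -> ~ null b -> 0 <= det a b ->
  axis_dir b = (cis (- (PI * INR (N_c a b) / 2)) * axis_dir a)%C.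
Proof.
intros Ha Hb HD.
assert (Sa := quadrant_signs a Ha). assert (Sb := quadrant_signs b Hb).
assert (HD2 : 0 <= (snd a + fst a) * (snd b - fst b) - (snd a - fst a) * (snd b + fst b)).
{ replace (_ - _) with (2 * det a b) by (unfold det; ring). lra. }
rewrite cis_N_c by (rewrite N_c_quadrant by assumption;
  destruct (quadrant_of a), (quadrant_of b); lia).
rewrite N_c_quadrant by assumption.
unfold axis_dir.
set (ua := snd a - fst a) in *. set (va := snd a + fst a) in *.
set (ub := snd b - fst b) in *. set (vb := snd b + fst b) in *.
destruct (quadrant_of a), (quadrant_of b);
try (exfalso; nra); unfold Cmult, Copp, Ci, RtoC; simpl; f_equal; ring.
Qed.

Lemma axis_dir_neq_0 (x : vec) : axis_dir x <> 0.
Proof.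
unfold axis_dir. destruct (quadrant_of x); intros E; unfold Copp, Ci, RtoC in E; simpl in E;
injection E; lra.
Qed.

Definition dihedral_ext (s : pm) (a b : vec) (phi : R) : C :=
  (pmR s * ((- (PI * INR (N_c a b) / 2))%R
            - orient a b * (axis_angle a phi - axis_angle b phi)))%C.

Lemma dihedral_ext_flip (s : pm) (a b : vec) (phi : R) :
  dihedral_ext (flip s) a b phi = (- dihedral_ext s a b phi)%C.
Proof.
unfold dihedral_ext. replace (pmR (flip s)) with (- pmR s) by (destruct s; simpl; ring).
rewrite RtoC_opp. ring.
Qed.

Lemma axis_dir_orient (a b : vec) : ~ null a -> ~ null b ->
  axis_dir b = (cis (orient a b * - (PI * INR (N_c a b) / 2)) * axis_dir a)%C.
Proof.
intros Ha Hb. unfold orient. destruct (Rle_dec 0 (det a b)) as [h|h].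
- rewrite Rmult_1_l. apply axis_dir_turn; assumption.
- assert (h' : 0 <= det b a) by (unfold det in *; lra).
  rewrite (axis_dir_turn b a Hb Ha h'), N_c_sym by assumption.
  rewrite Cmult_assoc, <- cis_plus.
  replace (_ + _) with 0 by ring.
  unfold cis; rewrite cos_0, sin_0. change (1, 0) with (RtoC 1). ring.
Qed.

Lemma iexp_R (t : R) : iexp t = cis t.
Proof.
unfold iexp; simpl. rewrite Ropp_0, exp_0. ring.
Qed.

(** With F = x_1 - i w x_0, G = x_1 + i w x_0 and U as in [polar_factors], the numerator is F_a G_b
    or G_a F_b according to the sign [pmR s * orient a b], and the denominator is F_a U_a F_b U_b.
    Since G = F U^2, the quotient is U_b / U_a or its inverse, and [axis_dir_orient] turns the axis
    directions into the term with N_c. *)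
Lemma dihedral_arg_iexp (s : pm) (a b : vec) (phi : R) : ~ null a -> ~ null b ->
  - PI < phi <= PI -> dihedral_arg s a b phi = iexp (dihedral_ext s a b phi).
Proof.
intros Ha Hb Hphi. unfold dihedral_arg.
rewrite !Csqrt_star by assumption.
destruct (polar_factors a phi Ha) as [Fa Ga]. destruct (polar_factors b phi Hb) as [Fb Gb].
cbv zeta in *.
set (w := cis (phi / 2)) in *.
assert (HN : (star phi a b - pmR s * 2 * Ci * w * area a b)%C =
   (snd a * snd b + w * w * (fst a * fst b) - pmR s * orient a b * Ci * w * det a b)%C).
{ unfold star. replace phi with (phi / 2 + phi / 2) at 1 by field.
  rewrite cis_plus, !RtoC_mult. fold w.
  transitivity (snd a * snd b + w * w * (fst a * fst b) - pmR s * Ci * w * (2 * area a b)%R)%C.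
  - rewrite (RtoC_mult 2). ring.
  - rewrite area_orient, RtoC_mult. ring. }
rewrite HN. clear HN.
assert (Ea := iexp_neq_0 (axis_angle a phi)). assert (Eb := iexp_neq_0 (axis_angle b phi)).
assert (Da := axis_dir_neq_0 a). assert (Db := axis_dir_neq_0 b).
assert (Dab := axis_dir_orient a b Ha Hb).
set (t := orient a b * - (PI * INR (N_c a b) / 2)) in *.
set (Ua := (axis_dir a * iexp (axis_angle a phi))%C) in *.
set (Ub := (axis_dir b * iexp (axis_angle b phi))%C) in *.
assert (Hab : iexp (t - (axis_angle a phi - axis_angle b phi)) = (Ub / Ua)%C).
{ unfold Cminus. rewrite iexp_plus, iexp_R, iexp_opp. 
  rewrite iexp_plus, iexp_opp. unfold Ub, Ua. rewrite Dab. field. auto. }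
assert (HUa : Ua <> 0) by (apply Cmult_neq_0; assumption).
assert (HUb : Ub <> 0) by (apply Cmult_neq_0; assumption).
assert (Hoo : (orient a b * orient a b)%C = 1%C).
{ unfold orient. destruct (Rle_dec 0 (det a b)); unfold Cmult, RtoC; simpl; f_equal; ring. }
assert (HD : RtoC (det a b) = (fst a * snd b - snd a * fst b)%C).
{ unfold det. rewrite RtoC_minus, !RtoC_mult. reflexivity. }
assert (HC : (Ci * Ci)%C = (-1)%C) by (unfold Ci, Cmult, RtoC; simpl; f_equal; ring).
assert (Ht : dihedral_ext s a b phi = (pmR s * orient a b *
   (t - (axis_angle a phi - axis_angle b phi)))%C).
{ unfold dihedral_ext, t. rewrite RtoC_mult.
  set (n := RtoC (- _)).
  transitivity (pmR s * ((orient a b * orient a b) * n - orient a b * (axis_angle a phi - axis_angle b phi)))%C;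
  [rewrite Hoo; ring | ring]. }
rewrite Ht, HD.
assert (Hs : (pmR s * orient a b)%C = 1%C \/ (pmR s * orient a b)%C = (-1)%C).
{ unfold orient. destruct s, (Rle_dec 0 (det a b)); simpl; [left|right|right|left]; unfold Cmult, RtoC; simpl; f_equal; ring. }
destruct Hs as [->| ->].
- rewrite !Cmult_1_l, Hab.
  transitivity ((snd a - Ci * w * fst a) * (snd b + Ci * w * fst b)
      / ((snd a - Ci * w * fst a) * Ua * ((snd b - Ci * w * fst b) * Ub)))%C.
  + f_equal. transitivity (snd a * snd b - (Ci * Ci) * (w * w * (fst a * fst b)) - Ci * w * (fst a * snd b - snd a * fst b))%C;
    [rewrite HC; ring | ring].
  + rewrite <- Gb. field. auto.
- replace (-1 * (t - (axis_angle a phi - axis_angle b phi)))%C with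
    (- (t - (axis_angle a phi - axis_angle b phi)))%C by ring.
  rewrite iexp_opp, Hab.
  transitivity ((snd a + Ci * w * fst a) * (snd b - Ci * w * fst b)
      / ((snd a - Ci * w * fst a) * Ua * ((snd b - Ci * w * fst b) * Ub)))%C.
  + f_equal. transitivity (snd a * snd b - (Ci * Ci) * (w * w * (fst a * fst b)) + Ci * w * (fst a * snd b - snd a * fst b))%C;
    [rewrite HC; ring | ring].
  + rewrite <- Ga. field. auto.
Qed.

(** * Range of the real part and branches of the logarithm *)

Lemma dihedral_ext_Re (s : pm) (a b : vec) (phi : R) :
  Re (dihedral_ext s a b phi) = pmR s * (- (PI * INR (N_c a b) / 2)
     - orient a b * (Re (axis_angle a phi) - Re (axis_angle b phi))).
Proof. unfold dihedral_ext. simpl. ring. Qed.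

Lemma dihedral_ext_Im (s : pm) (a b : vec) (phi : R) :
  Im (dihedral_ext s a b phi) =
    - pmR s * orient a b * (Im (axis_angle a phi) - Im (axis_angle b phi)).
Proof. unfold dihedral_ext. simpl. ring. Qed.

Lemma N_c_le_2 (a b : vec) : ~ null a -> ~ null b -> (N_c a b <= 2)%nat.
Proof.
intros Ha Hb. rewrite N_c_quadrant by assumption.
destruct (quadrant_of a), (quadrant_of b); lia.
Qed.

Lemma N_c_2_signs (a b : vec) : ~ null a -> ~ null b -> N_c a b = 2%nat ->
  edot a b < 0 /\ 0 < mdot a a * mdot b b.
Proof.
intros Ha Hb. rewrite N_c_crossings by assumption. unfold crossings.
destruct (Rlt_dec _ 0) as [h|h]; destruct (Rlt_dec ((snd a + fst a) * _) 0) as [h'|h'];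
  intros H; try discriminate. clear H.
unfold edot, mdot. split; [lra|].
replace (_ * _) with ((- ((snd a - fst a) * (snd b - fst b))) * (- ((snd a + fst a) * (snd b + fst b)))) by ring.
apply Rmult_lt_0_compat; lra.
Qed.

(** Compares the arguments of the two arctangents. In opposite quadrants [edot a b] is negative and
    the denominator positive, so for positive [c] the difference has the sign opposite to [det a b],
    and monotonicity of [atan] carries this over to g_a - g_b. *)
Lemma axis_angle_ratio_diff (a b : vec) (c : R) : ~ null a -> ~ null b ->
  2 * fst a * snd a * c / mdot a a - 2 * fst b * snd b * c / mdot b b
  = det a b * (2 * c * edot a b / (mdot a a * mdot b b)).
Proof.
intros Ha Hb. unfold null, det, edot, mdot in *. field. split; assumption.
Qed.

(* Opposite quadrants are the only case in which |Re g| < PI / 4 does not keep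
   the real part of the angle inside the range of the logarithm. *)
Lemma axis_angle_opposite (a b : vec) (phi : R) : ~ null a -> ~ null b ->
  N_c a b = 2%nat -> 0 <= cos (phi / 2) ->
  orient a b * (Re (axis_angle a phi) - Re (axis_angle b phi)) <= 0 /\
  (0 < cos (phi / 2) -> det a b <> 0 ->
   orient a b * (Re (axis_angle a phi) - Re (axis_angle b phi)) < 0).
Proof.
intros Ha Hb HN Hc. destruct (N_c_2_signs a b Ha Hb HN) as [He Hm].
assert (Hd := axis_angle_ratio_diff a b (cos (phi / 2)) Ha Hb).
unfold axis_angle, Re; cbn [fst].
set (y := 2 * fst a * snd a * cos (phi / 2) / mdot a a) in *.
set (y' := 2 * fst b * snd b * cos (phi / 2) / mdot b b) in *.
set (k := 2 * cos (phi / 2) * edot a b / (mdot a a * mdot b b)) in *.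
assert (Hi : 0 < / (mdot a a * mdot b b)) by (apply Rinv_0_lt_compat, Hm).
assert (Hk : k <= 0).
{ unfold k, Rdiv. assert (0 <= 2 * cos (phi / 2) * - edot a b * / (mdot a a * mdot b b)); [|lra].
  apply Rmult_le_pos; [|lra]. apply Rmult_le_pos; lra. }
assert (Hks : 0 < cos (phi / 2) -> k < 0).
{ intros H. unfold k, Rdiv. assert (0 < 2 * cos (phi / 2) * - edot a b * / (mdot a a * mdot b b)); [|lra].
  apply Rmult_lt_0_compat; [|lra]. apply Rmult_lt_0_compat; lra. }
clearbody k.
assert (Hinc : forall u v, u <= v -> atan u <= atan v).
{ intros u v [h|h]; [left; apply atan_increasing, h | right; f_equal; exact h]. }
unfold orient. destruct (Rle_dec 0 (det a b)) as [h|h].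
- split.
  + assert (y <= y') by nra. specialize (Hinc _ _ H). lra.
  + intros H1 H2. assert (y < y') by (specialize (Hks H1); nra).
    assert (HH := atan_increasing _ _ H). lra.
- split.
  + assert (y' <= y) by nra. specialize (Hinc _ _ H). lra.
  + intros H1 H2. assert (y' < y) by (specialize (Hks H1); nra).
    assert (HH := atan_increasing _ _ H). lra.
Qed.

Lemma det_0_antiparallel (a b : vec) : ~ null a -> ~ null b ->
  N_c a b = 2%nat -> det a b = 0 -> antiparallel a b.
Proof.
intros Ha Hb HN HD. destruct (N_c_2_signs a b Ha Hb HN) as [He _].
assert (Hpos : 0 < edot a a).
{ unfold null, mdot, edot in *. destruct (Req_dec (snd a) 0) as [E|E]; [|nra].
  rewrite E in *. nra. }
(* The coefficient of the Euclidean orthogonal projection of b onto the line of a. *)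
exists (edot a b / edot a a). split.
- apply Rdiv_neg_pos; assumption.
- rewrite (surjective_pairing b) at 1. unfold vscal.
  f_equal; apply (Rmult_eq_reg_r (edot a a)); try lra.
  + replace (edot a b / edot a a * fst a * edot a a) with (edot a b * fst a) by (field; lra).
    transitivity (edot a b * fst a - snd a * det a b); [unfold edot, det; ring | rewrite HD; ring].
  + replace (edot a b / edot a a * snd a * edot a a) with (edot a b * snd a) by (field; lra).
    transitivity (edot a b * snd a + fst a * det a b); [unfold edot, det; ring | rewrite HD; ring].
Qed.

(** As |Re (g_a - g_b)| < PI / 2, N_c = 0 and N_c = 1 give the intervals (- PI / 2, PI / 2) and (-
    PI, 0); N_c = 2 needs [axis_angle_opposite]. The value - PI does occur, for instance at phi = PI
    with N_c = 2, which is why log_- goes with theta^+. The strict form serves the principal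
    logarithm of the definition. *)
Lemma dihedral_ext_range (a b : vec) (phi : R) : ~ null a -> ~ null b ->
  0 <= cos (phi / 2) ->
  - PI <= Re (dihedral_ext Upper a b phi) < PI /\
  (0 < cos (phi / 2) -> ~ antiparallel a b -> - PI < Re (dihedral_ext Upper a b phi)).
Proof.
intros Ha Hb Hc. rewrite dihedral_ext_Re. change (pmR Upper) with 1. rewrite Rmult_1_l.
assert (Hpi := PI_RGT_0).
assert (Ba := axis_angle_Re_bound a phi). assert (Bb := axis_angle_Re_bound b phi).
assert (HN := N_c_le_2 a b Ha Hb). assert (Ho := axis_angle_opposite a b phi Ha Hb).
assert (HA := det_0_antiparallel a b Ha Hb).
set (d := orient a b * (Re (axis_angle a phi) - Re (axis_angle b phi))) in *.
assert (Hd : - (PI / 2) < d < PI / 2).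
{ unfold d, orient. destruct (Rle_dec 0 (det a b)); lra. }
destruct (N_c a b) as [|[|[|n]]]; [| | |lia]; simpl INR; try lra.
destruct (Ho eq_refl Hc) as [H1 H2]. split; [lra|].
intros Hc0 Hna. assert (det a b <> 0) by (intros E; apply Hna, HA; [reflexivity | exact E]).
specialize (H2 Hc0 H). lra.
Qed.

Lemma cos_half_ge_0 (phi : R) : - PI <= phi <= PI -> 0 <= cos (phi / 2).
Proof. intros H. apply cos_ge_0; lra. Qed.

Lemma dihedral_ext_clog (s : pm) (a b : vec) (phi : R) : ~ null a -> ~ null b ->
  - PI < phi <= PI ->
  dihedral_ext s a b phi = (- Ci * clog (flip s) (dihedral_arg s a b phi))%C.
Proof.
intros Ha Hb Hphi. rewrite dihedral_arg_iexp by assumption.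
symmetry. apply clog_iexp.
destruct (dihedral_ext_range a b phi Ha Hb) as [H _]; [apply cos_half_ge_0; lra|].
destruct s; [exact H|].
change (- PI < Re (dihedral_ext (flip Upper) a b phi) <= PI). rewrite dihedral_ext_flip.
change (- PI < - Re (dihedral_ext Upper a b phi) <= PI). lra.
Qed.

Lemma dihedral_ext_shift (s : pm) (a b : vec) (phi : R) :
  dihedral_ext s a b (phi + 2 * PI) =
    (- (pmR s * INR (N_c a b) * PI)%R - dihedral_ext s a b phi)%C.
Proof.
unfold dihedral_ext. rewrite !axis_angle_shift.
replace (pmR s * INR (N_c a b) * PI) with (- (pmR s * (2 * - (PI * INR (N_c a b) / 2)))) by field.
set (n := - (PI * INR (N_c a b) / 2)).
rewrite RtoC_opp, !RtoC_mult. ring.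
Qed.

Lemma star_shift (phi : R) (x y : vec) : star (phi + 2 * PI) x y = star phi x y.
Proof.
unfold star, cis. rewrite cos_plus, sin_plus, cos_2PI, sin_2PI. do 3 f_equal; ring.
Qed.

Lemma dihedral_arg_shift (s : pm) (a b : vec) (phi : R) :
  dihedral_arg s a b (phi + 2 * PI) = dihedral_arg (flip s) a b phi.
Proof.
unfold dihedral_arg. rewrite !star_shift. f_equal.
replace ((phi + 2 * PI) / 2) with (phi / 2 + PI) by field. rewrite cis_plus.
assert (E : cis PI = (-1)%C) by (unfold cis; rewrite cos_PI, sin_PI; reflexivity).
rewrite E. assert (E' : RtoC (pmR (flip s)) = (- RtoC (pmR s))%C).
{ rewrite <- RtoC_opp. f_equal. destruct s; simpl; ring. }
rewrite E'. ring.
Qed.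

(** A shift by 2 PI into (- PI, PI] leaves the star products unchanged and reverses exp (i phi / 2),
    so the formula is [dihedral_ext_clog] for the other sign. *)
Lemma dihedral_ext_clog_outer (s : pm) (a b : vec) (phi : R) : ~ null a -> ~ null b ->
  - 2 * PI < phi <= - PI \/ PI < phi <= 2 * PI ->
  dihedral_ext s a b phi = (- Ci * clog s (dihedral_arg s a b phi)
                       - (pmR s * INR (N_c a b) * PI)%R)%C.
Proof.
intros Ha Hb [H|H].
- assert (E := dihedral_ext_clog (flip s) a b (phi + 2 * PI) Ha Hb ltac:(lra)).
  rewrite dihedral_arg_shift, dihedral_ext_flip, dihedral_ext_shift in E.
  replace (flip (flip s)) with s in E by (destruct s; reflexivity).
  rewrite <- E. ring.
- assert (E := dihedral_ext_clog (flip s) a b (phi - 2 * PI) Ha Hb ltac:(lra)).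
  rewrite <- dihedral_arg_shift, dihedral_ext_flip in E.
  replace (flip (flip s)) with s in E by (destruct s; reflexivity).
  replace phi with (phi - 2 * PI + 2 * PI) at 1 2 by ring. 
  rewrite dihedral_ext_shift, <- E. ring.
Qed.

(** For antiparallel vectors g_a and g_b therefore cancel, and the extension is the constant
    prescribed for them. *)
Lemma axis_angle_scal (x : vec) (t phi : R) : ~ null x -> t <> 0 ->
  axis_angle (vscal t x) phi = axis_angle x phi.
Proof.
intros Hx Ht. destruct (edot_pm_sin_gt x (phi / 2) Hx) as [HA HB].
assert (Htt : 0 < t * t) by (apply Rsqr_pos_lt, Ht).
unfold axis_angle. f_equal.
- do 2 f_equal. unfold null, vscal, mdot in *. cbn [fst snd] in *. field. split; [lra|].
  replace (_ + _) with (t * t * (- (fst x * fst x) + snd x * snd x)) by ring.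
  apply Rmult_integral_contrapositive; split; lra.
- set (s := sin (phi / 2)) in *.
  replace (edot (vscal t x) (vscal t x) + 2 * fst (vscal t x) * snd (vscal t x) * s)
    with (t * t * (edot x x + 2 * fst x * snd x * s)) by (unfold edot, vscal; simpl; ring).
  replace (edot (vscal t x) (vscal t x) - 2 * fst (vscal t x) * snd (vscal t x) * s)
    with (t * t * (edot x x - 2 * fst x * snd x * s)) by (unfold edot, vscal; simpl; ring).
  rewrite !(ln_mult (t * t)) by assumption. ring.
Qed.

Lemma dihedral_ext_dihedral (s : pm) (a b : vec) (phi : R) : ~ null a -> ~ null b ->
  dihedral_domain s phi -> dihedral_ext s a b phi = dihedral s a b phi.
Proof.
intros Ha Hb Hphi. unfold dihedral.
destruct (excluded_middle_informative (antiparallel a b)) as [HA|HA].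
- assert (HN : N_c a b = 2%nat).
  { unfold N_c. destruct (excluded_middle_informative _); [reflexivity | contradiction]. }
  destruct HA as [t [Ht ->]].
  unfold dihedral_ext. rewrite HN, axis_angle_scal by (assumption || lra).
  replace (- (PI * INR 2 / 2)) with (- PI) by (simpl; field).
  rewrite RtoC_mult, !RtoC_opp. ring.
- assert (Hpi := PI_RGT_0).
  assert (Hphi' : - PI < phi < PI) by (destruct s; simpl in Hphi; lra).
  unfold dihedral_formula.
  (* The radicand is - w^2 det(a, b)^2. The real part of the chosen root is
     [pmR s * 2 * sin (phi / 2) * area a b], non-negative because [sin (phi / 2)] has the sign of
     [pmR s] on the domain; this is how the half-line of phi fixes the sign in [dihedral_arg]. *)
  assert (HS : Csqrt (star phi a b ^ 2 - star phi a a * star phi b b) =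
    (- (pmR s * 2 * Ci * cis (phi / 2) * area a b))%C).
  { set (z := (- (pmR s * 2 * Ci * cis (phi / 2) * area a b))%C).
    assert (E : (z * z)%C = (star phi a b ^ 2 - star phi a a * star phi b b)%C).
    { unfold z, star. replace phi with (phi / 2 + phi / 2) at 3 4 5 by field.
      set (w := cis (phi / 2)).
      assert (HC : (Ci * Ci)%C = (-1)%C) by (unfold Ci, Cmult, RtoC; simpl; f_equal; ring).
      assert (Hp : (pmR s * pmR s)%C = 1%C) by (destruct s; unfold Cmult, RtoC; simpl; f_equal; ring).
      transitivity ((Ci * Ci) * (pmR s * pmR s) * (w * w) * ((2 * area a b)%R * (2 * area a b)%R))%C.
      { rewrite RtoC_mult. ring. }
      rewrite HC, Hp, area_orient, !RtoC_mult, cis_plus. fold w.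
      assert (Hoo : (orient a b * orient a b)%C = 1%C).
      { unfold orient. destruct (Rle_dec 0 (det a b)); unfold Cmult, RtoC; simpl; f_equal; ring. }
      transitivity (- (w * w * (orient a b * orient a b) * (det a b * det a b)))%C; [ring|].
      rewrite Hoo. unfold det. rewrite RtoC_minus, !RtoC_mult. ring. }
    rewrite <- E. apply Csqrt_sqr.
    assert (Hr : Re z = pmR s * 2 * sin (phi / 2) * area a b) by (unfold z, cis; simpl; ring).
    assert (Hz : Im z = - (pmR s * 2 * cos (phi / 2) * area a b)) by (unfold z, cis; simpl; ring).
    assert (Har : 0 <= area a b) by (unfold area; assert (HH := Rabs_pos (fst a * snd b - snd a * fst b)); lra).
    assert (Hs : 0 < pmR s * 2 * sin (phi / 2)).
    { destruct s; simpl in *.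
      - assert (0 < sin (phi / 2)) by (apply sin_gt_0; lra). lra.
      - assert (0 < sin (- (phi / 2))) by (apply sin_gt_0; lra). rewrite sin_neg in *. lra. }
    destruct Har as [h|h].
    - left. rewrite Hr. apply Rmult_lt_0_compat; assumption.
    - right. rewrite Hr, Hz, <- h. split; lra. }
  rewrite HS.
  change (star phi a b + - ?z)%C with (star phi a b - z)%C.
  change (_ / _)%C with (dihedral_arg s a b phi).
  rewrite dihedral_arg_iexp by (assumption || lra).
  symmetry. apply clog_iexp.
  assert (Hc : 0 < cos (phi / 2)) by (apply cos_gt_0; lra).
  destruct (dihedral_ext_range a b phi Ha Hb) as [H1 H2]; [lra|].
  (* The principal logarithm omits the argument - PI, so the upper sign needs the strict bound. *)
  specialize (H2 Hc HA).
  destruct s; [change (- PI < Re (dihedral_ext Upper a b phi) <= PI); lra|].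
  change (- PI < Re (dihedral_ext (flip Upper) a b phi) <= PI). rewrite dihedral_ext_flip.
  change (- PI < - Re (dihedral_ext Upper a b phi) <= PI). lra.
Qed.

Lemma real_analytic_dihedral_ext (s : pm) (a b : vec) : ~ null a -> ~ null b ->
  real_analytic (dihedral_ext s a b).
Proof.
intros Ha Hb. apply real_analytic_iff. intros x.
destruct (proj1 (real_analytic_iff _) (real_analytic_axis_angle a Ha) x) as [A1 A2].
destruct (proj1 (real_analytic_iff _) (real_analytic_axis_angle b Hb) x) as [B1 B2].
split.
- apply (analytic_at_ext (fun y => pmR s * (- (PI * INR (N_c a b) / 2)
     + - orient a b * (fst (axis_angle a y) + -1 * fst (axis_angle b y))))).
  + intros y. symmetry. etransitivity; [apply dihedral_ext_Re|]. unfold Re. ring.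
  + repeat (assumption || apply analytic_at_const || (apply analytic_at_mult; [apply analytic_at_const|]) || apply analytic_at_plus).
- apply (analytic_at_ext (fun y => (- pmR s * orient a b) * (snd (axis_angle a y) + -1 * snd (axis_angle b y)))).
  + intros y. symmetry. etransitivity; [apply dihedral_ext_Im|]. unfold Im. ring.
  + repeat (assumption || apply analytic_at_const || (apply analytic_at_mult; [apply analytic_at_const|]) || apply analytic_at_plus).
Qed.

(** * Euclidean and Lorentzian data *)

Lemma Cmod_iexp (z : C) : Cmod (iexp z) = exp (- Im z).
Proof. apply Cmod_scal_cis, exp_pos. Qed.

Lemma Cmod_Csqrt (z : C) : Cmod (Csqrt z) = sqrt (Cmod z).
Proof.
unfold Csqrt. rewrite Cmod_mult, Cmod_cis, Cmod_R, Rabs_pos_eq by apply sqrt_pos. ring.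
Qed.

Lemma Csqrt_pos (x : R) : 0 <= x -> Csqrt x = sqrt x.
Proof.
intros Hx. rewrite <- (sqrt_sqrt x Hx) at 1. rewrite RtoC_mult. apply Csqrt_sqr.
simpl. assert (H := sqrt_pos x). lra.
Qed.

Lemma edot_ge_0 (x : vec) : 0 <= edot x x.
Proof. unfold edot. nra. Qed.

Lemma dihedral_ext_0 (s : pm) (a b : vec) : ~ null a -> ~ null b ->
  dihedral_ext s a b 0 = RtoC (- pmR s * psi_E a b).
Proof.
intros Ha Hb.
assert (HU : dihedral_ext Upper a b 0 = RtoC (- psi_E a b)).
{ assert (Hpi := PI_RGT_0).
  destruct (dihedral_ext_range a b 0 Ha Hb) as [H _]; [apply cos_half_ge_0; lra|].
  assert (HE := dihedral_arg_iexp Upper a b 0 Ha Hb ltac:(lra)).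
  assert (HI : Im (dihedral_ext Upper a b 0) = 0).
  { rewrite dihedral_ext_Im. unfold axis_angle; simpl.
    replace (0 / 2) with 0 by field. rewrite sin_0, !Rmult_0_r, !Rplus_0_r, !Rminus_0_r. ring. }
  rewrite (surjective_pairing (dihedral_ext Upper a b 0)) in HE |- *.
  change (snd (dihedral_ext Upper a b 0)) with (Im (dihedral_ext Upper a b 0)) in *.
  change (fst (dihedral_ext Upper a b 0)) with (Re (dihedral_ext Upper a b 0)) in *.
  rewrite HI in *. set (t := Re (dihedral_ext Upper a b 0)) in *.
  change (t, 0) with (RtoC t) in *. rewrite iexp_R in HE. f_equal.
  unfold dihedral_arg in HE. rewrite !star_0, !Csqrt_pos in HE by apply edot_ge_0.
  replace (0 / 2) with 0 in HE by field.
  assert (Hp : forall x, ~ null x -> 0 < edot x x).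
  { intros x Hx. assert (HH := edot_gt x 0 Hx ltac:(lra)). lra. }
  assert (Pa := sqrt_lt_R0 _ (Hp a Ha)). assert (Pb := sqrt_lt_R0 _ (Hp b Hb)).
  set (n := sqrt (edot a a) * sqrt (edot b b)).
  assert (Pn : 0 < n) by (apply Rmult_lt_0_compat; assumption).
  assert (Hn : RtoC n = (sqrt (edot a a) * sqrt (edot b b))%C) by apply RtoC_mult.
  rewrite <- Hn in HE.
  assert (HE' : (edot a b - pmR Upper * 2 * Ci * cis 0 * area a b)%C = (n * cis t)%C).
  { rewrite <- HE. field. intros E; injection E; lra. }
  unfold cis in HE'. rewrite cos_0, sin_0 in HE'.
  unfold Cminus, Cplus, Copp, Cmult, Ci, RtoC in HE'; simpl in HE'.
  injection HE'; intros E2 E1.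
  assert (Har : 0 <= area a b) by (unfold area; assert (HH := Rabs_pos (fst a * snd b - snd a * fst b)); lra).
  (* The imaginary part [- 2 * area a b] is non-positive, so [t], already known to lie in [- PI,
     PI), is minus an arccosine. *)
  assert (Ht : t <= 0).
  { destruct (Rle_dec t 0); [assumption|exfalso].
    assert (0 < n * sin t) by (apply Rmult_lt_0_compat; [|apply sin_gt_0]; lra). lra. }
  unfold psi_E. fold n.
  replace (edot a b / n) with (cos (- t)).
  - rewrite acos_cos by lra. ring.
  - rewrite cos_neg. apply (Rmult_eq_reg_l n); [|lra]. field_simplify; lra. }
destruct s.
- rewrite HU. simpl. f_equal. ring.
- change (dihedral_ext Lower a b 0) with (dihedral_ext (flip Upper) a b 0).
  rewrite dihedral_ext_flip, HU, <- RtoC_opp. f_equal. simpl. ring.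
Qed.

Definition mink_norm (x : vec) : R := sqrt (Rabs (mdot x x)).

Lemma mink_norm_gt_0 (x : vec) : ~ null x -> 0 < mink_norm x.
Proof. intros Hx. apply sqrt_lt_R0, Rabs_pos_lt, Hx. Qed.

Lemma mdot_hat (a b : vec) : ~ null a -> ~ null b ->
  mdot (hat a) (hat b) = mdot a b / (mink_norm a * mink_norm b).
Proof.
intros Ha Hb. assert (Pa := mink_norm_gt_0 a Ha). assert (Pb := mink_norm_gt_0 b Hb).
unfold hat, vscal. fold (mink_norm a) (mink_norm b). unfold mdot; cbn [fst snd].
field. lra.
Qed.

Lemma arcosh_abs (u d : R) : 0 <= d -> u * u - d * d = 1 -> 0 < u ->
  arcosh u = ln (Rabs (u + d)).
Proof.
intros Hd E Hu. unfold arcosh. rewrite Rabs_pos_eq by lra. do 2 f_equal.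
apply sqrt_lem_1; nra.
Qed.

Lemma arcosh_opp_abs (u d : R) : 0 <= d -> u * u - d * d = 1 -> u < 0 ->
  arcosh (- u) = - ln (Rabs (u + d)).
Proof.
intros Hd E Hu. rewrite <- (Ropp_involutive (arcosh (- u))). f_equal. unfold arcosh.
replace (sqrt ((- u) ^ 2 - 1)) with d by (symmetry; apply sqrt_lem_1; nra).
rewrite <- ln_Rinv by lra. f_equal.
assert (u + d < 0) by nra.
rewrite Rabs_left by assumption. apply (Rmult_eq_reg_l (- u + d)); [|lra].
rewrite Rinv_r by lra. lra.
Qed.

Lemma arcsinh_abs (u d : R) : 0 <= d -> u * u - d * d = -1 ->
  arcsinh u = ln (Rabs (u + d)).
Proof.
intros Hd E. unfold arcsinh.
replace (sqrt (u ^ 2 + 1)) with d by (symmetry; apply sqrt_lem_1; nra).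
rewrite Rabs_pos_eq; [reflexivity | nra].
Qed.

(** With [u] the normalized product and [d] the normalized doubled area, (a.b)^2 - 4 |A|^2 = (a.a)
    (b.b) gives u^2 - d^2 = 1 or -1. In each case of the definition the real part is then ln |u +
    d|; for negative [u], |u + d| is the inverse of - u + d, which accounts for the minus sign
    before [arcosh (- u)]. *)
Lemma psi_L_E (s : pm) (a b : vec) : ~ null a -> ~ null b ->
  psi_L s a b =
    (ln (Rabs ((mdot a b + 2 * area a b) / (mink_norm a * mink_norm b))),
     - pmR s * (PI * INR (N_c a b) / 2)).
Proof.
intros Ha Hb. assert (Pa := mink_norm_gt_0 a Ha). assert (Pb := mink_norm_gt_0 b Hb).
set (n := mink_norm a * mink_norm b).
assert (Pn : 0 < n) by (apply Rmult_lt_0_compat; assumption).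
set (u := mdot a b / n). set (d := 2 * area a b / n).
assert (Har : 0 <= area a b) by (unfold area; assert (HH := Rabs_pos (fst a * snd b - snd a * fst b)); lra).
assert (Hd : 0 <= d) by (apply Rmult_le_pos; [lra | left; apply Rinv_0_lt_compat, Pn]).
replace ((mdot a b + 2 * area a b) / n) with (u + d) by (unfold u, d; field; lra).
assert (Hnn : n * n = Rabs (mdot a a * mdot b b)).
{ rewrite Rabs_mult. unfold n, mink_norm.
  rewrite <- (sqrt_sqrt (Rabs (mdot a a))) at 3 by apply Rabs_pos.
  rewrite <- (sqrt_sqrt (Rabs (mdot b b))) at 3 by apply Rabs_pos. ring. }
assert (Hoo : orient a b * orient a b = 1).
{ unfold orient. destruct (Rle_dec 0 (det a b)); ring. }
assert (Hud : (u * u - d * d) * (n * n) = mdot a a * mdot b b).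
{ unfold u, d. rewrite area_orient.
  transitivity (mdot a b * mdot a b - (orient a b * orient a b) * (det a b * det a b)).
  - field. lra.
  - rewrite Hoo. unfold mdot, det. ring. }
assert (Hun : u * n = mdot a b) by (unfold u; field; lra).
assert (Sa := quadrant_signs a Ha). assert (Sb := quadrant_signs b Hb).
rewrite N_c_quadrant by assumption.
unfold psi_L. rewrite mdot_hat by assumption. fold n u.
assert (HM : mdot a a * mdot b b = (snd a - fst a) * (snd a + fst a) * ((snd b - fst b) * (snd b + fst b)))
  by (unfold mdot; ring).
assert (Hm : 2 * (u * n) = (snd a - fst a) * (snd b + fst b) + (snd a + fst a) * (snd b - fst b))
  by (rewrite Hun; unfold mdot; ring).
rewrite HM in Hud, Hnn. clear HM Hun.
set (ua := snd a - fst a) in *. set (va := snd a + fst a) in *.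
set (ub := snd b - fst b) in *. set (vb := snd b + fst b) in *.
assert (Hpos : 0 < ua * va * (ub * vb) -> u * u - d * d = 1).
{ intros H. rewrite Rabs_pos_eq in Hnn by lra. rewrite <- Hnn in Hud, H.
  apply (Rmult_eq_reg_r (n * n)); lra. }
assert (Hneg : ua * va * (ub * vb) < 0 -> u * u - d * d = -1).
{ intros H. rewrite Rabs_left in Hnn by lra.
  apply (Rmult_eq_reg_r (n * n)); lra. }
assert (Hup : 0 < ua * vb + va * ub -> 0 < u) by (intros; nra).
assert (Hun : ua * vb + va * ub < 0 -> u < 0) by (intros; nra).
assert (HA := arcosh_abs u d Hd). assert (HB := arcosh_opp_abs u d Hd).
assert (HC := arcsinh_abs u d Hd).
assert (Sp : forall p q, 0 < p -> 0 < q -> 0 < p * q) by (intros; apply Rmult_lt_0_compat; assumption).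
assert (Sn : forall p q, p < 0 -> q < 0 -> 0 < p * q) by (intros; nra).
assert (Sm : forall p q, p < 0 -> 0 < q -> p * q < 0) by (intros; nra).
assert (Sm' : forall p q, 0 < p -> q < 0 -> p * q < 0) by (intros; nra).
destruct (quadrant_of a), (quadrant_of b); destruct Sa as [Sa Sa'], Sb as [Sb Sb'];
first [ rewrite HC by (apply Hneg; auto)
      | rewrite HA by (first [apply Hpos; auto; fail | apply Hup, Rplus_lt_0_compat; auto])
      | rewrite HB by (first [apply Hpos; auto; fail | apply Hun; 
           assert (ua * vb < 0) by auto; assert (va * ub < 0) by auto; lra]) ];
unfold Ci, Cminus, Cplus, Copp, Cmult, RtoC; simpl; f_equal; field.
Qed.

(** At phi = PI the arctangents vanish with cos (PI / 2), which leaves the N_c term as real part.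
    The imaginary part is minus the logarithm of the modulus of [dihedral_arg], in which w = i turns
    - 2 i w |A| into 2 |A|, as in [psi_L_E]. *)
Lemma dihedral_ext_PI (a b : vec) : ~ null a -> ~ null b ->
  dihedral_ext Upper a b PI = (- Ci * psi_L Upper a b)%C.
Proof.
intros Ha Hb. assert (Hpi := PI_RGT_0).
assert (Pa := mink_norm_gt_0 a Ha). assert (Pb := mink_norm_gt_0 b Hb).
assert (HE := dihedral_arg_iexp Upper a b PI Ha Hb ltac:(lra)).
rewrite psi_L_E by assumption.
apply (f_equal Cmod) in HE. rewrite Cmod_iexp in HE.
assert (HI : ln (Cmod (dihedral_arg Upper a b PI)) = - Im (dihedral_ext Upper a b PI)).
{ rewrite HE. apply ln_exp. }
assert (HR : Re (dihedral_ext Upper a b PI) = - (PI * INR (N_c a b) / 2)).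
{ rewrite dihedral_ext_Re. unfold axis_angle; simpl. rewrite cos_PI2.
  unfold Rdiv. rewrite !Rmult_0_r, !Rmult_0_l, atan_0. ring. }
assert (HD : Cmod (dihedral_arg Upper a b PI) =
   Rabs ((mdot a b + 2 * area a b) / (mink_norm a * mink_norm b))).
{ unfold dihedral_arg. rewrite Cmod_div.
  2:{ intros E. apply (f_equal Cmod) in E.
      rewrite Cmod_mult, !Cmod_Csqrt, !star_PI, !Cmod_R, Rabs_R0 in E.
      change (mink_norm a * mink_norm b = 0) in E.
      apply Rmult_integral in E. lra. }
  rewrite Cmod_mult, !Cmod_Csqrt, !star_PI, !Cmod_R.
  change (sqrt (Rabs (mdot a a))) with (mink_norm a).
  change (sqrt (Rabs (mdot b b))) with (mink_norm b).
  unfold Rdiv. rewrite Rabs_mult, Rabs_inv, (Rabs_pos_eq (mink_norm a * _)).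
  2:{ left; apply Rmult_lt_0_compat; assumption. }
  f_equal. rewrite <- Cmod_R. f_equal.
  unfold cis. change (PI * / 2) with (PI / 2). rewrite cos_PI2, sin_PI2.
  unfold Ci, Cminus, Cplus, Copp, Cmult, RtoC; simpl. f_equal; ring. }
rewrite HD in HI.
rewrite (surjective_pairing (dihedral_ext Upper a b PI)).
change (fst ?z) with (Re z). change (snd ?z) with (Im z). rewrite HI.
change (fst (dihedral_ext Upper a b PI)) with (Re (dihedral_ext Upper a b PI)).
change (snd (dihedral_ext Upper a b PI)) with (Im (dihedral_ext Upper a b PI)).
rewrite HR. unfold Ci, Copp, Cmult; simpl. f_equal; ring.
Qed.

Lemma dihedral_ext_opp (s : pm) (a b : vec) (phi : R) :
  dihedral_ext s a b (- phi) = Cconj (dihedral_ext s a b phi).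
Proof.
unfold dihedral_ext. rewrite !axis_angle_opp.
unfold Cconj, Cminus, Cplus, Copp, Cmult, RtoC; simpl. f_equal; ring.
Qed.

Lemma psi_L_conj (a b : vec) : ~ null a -> ~ null b ->
  psi_L Lower a b = Cconj (psi_L Upper a b).
Proof.
intros Ha Hb. rewrite !psi_L_E by assumption. unfold Cconj; simpl. f_equal. ring.
Qed.

Theorem mainTheorem3 (a b : vec) (Ha : ~ null a) (Hb : ~ null b) :
  (exists theta : pm -> R -> C, forall s : pm,
     analytic_continuation (dihedral_domain s) (dihedral s a b) (theta s)) /\
  (forall theta : pm -> R -> C,
     (forall s : pm,
        analytic_continuation (dihedral_domain s) (dihedral s a b) (theta s)) ->
     (forall (s : pm) (phi : R), theta s (phi + 4 * PI) = theta s phi) /\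
     (forall (s : pm) (phi : R), - PI < phi <= PI ->
        theta s phi = (- Ci * clog (flip s) (dihedral_arg s a b phi))%C) /\
     (forall (s : pm) (phi : R),
        - 2 * PI < phi <= - PI \/ PI < phi <= 2 * PI ->
        theta s phi = (- Ci * clog s (dihedral_arg s a b phi)
                       - (pmR s * INR (N_c a b) * PI)%R)%C) /\
     (forall phi : R, theta Upper phi = (- theta Lower phi)%C) /\
     (forall (s : pm) (phi : R),
        Re (theta s (- phi)) = Re (theta s phi) /\
        Im (theta s (- phi)) = - Im (theta s phi)) /\
     (forall s : pm, Im (theta s 0) = 0 /\ Im (theta s (2 * PI)) = 0) /\
     (Re (theta Upper PI) = - PI * INR (N_c a b) / 2 /\
      Re (theta Upper (- PI)) = - PI * INR (N_c a b) / 2 /\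
      Re (theta Lower PI) = PI * INR (N_c a b) / 2 /\
      Re (theta Lower (- PI)) = PI * INR (N_c a b) / 2) /\
     (forall s : pm,
        theta s 0 = RtoC (- pmR s * psi_E a b) /\
        theta s (2 * PI)
          = RtoC (pmR s * psi_E a b - pmR s * PI * INR (N_c a b))) /\
     (forall s : pm,
        theta s PI = (- pmR s * Ci * psi_L Upper a b)%C /\
        theta s (- PI) = (pmR s * Ci * psi_L Lower a b)%C)).
Proof.
assert (Hext : forall s, analytic_continuation (dihedral_domain s) (dihedral s a b) (dihedral_ext s a b)).
{ intros s. split; [apply real_analytic_dihedral_ext; assumption|].
  intros phi Hphi. apply dihedral_ext_dihedral; assumption. }
split; [exists (fun s => dihedral_ext s a b); exact Hext|].
intros theta Htheta.
(* Both functions are analytic and equal [dihedral s a b] on the open interval belonging to [s], so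
   the identity theorem applies. *)
assert (E : forall s phi, theta s phi = dihedral_ext s a b phi).
{ intros s. destruct (Htheta s) as [H1 H2], (Hext s) as [H3 H4]. assert (Hpi := PI_RGT_0).
  destruct s; [apply (real_analytic_unique _ _ 0 PI) | apply (real_analytic_unique _ _ (- PI) 0)];
  try assumption; try lra; intros x Hx; rewrite H2, H4 by exact Hx; reflexivity. }
clear Htheta Hext.
assert (E0 := fun s => dihedral_ext_0 s a b Ha Hb).
assert (E2 : forall s, dihedral_ext s a b (2 * PI)
  = RtoC (pmR s * psi_E a b - pmR s * PI * INR (N_c a b))).
{ intros s. rewrite <- (Rplus_0_l (2 * PI)), dihedral_ext_shift, E0.
  rewrite <- RtoC_opp, <- RtoC_minus. f_equal. ring. }
assert (EP : forall s, dihedral_ext s a b PI = (- pmR s * Ci * psi_L Upper a b)%C).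
{ intros [|].
  - rewrite dihedral_ext_PI by assumption. simpl. ring.
  - change (dihedral_ext Lower a b PI) with (dihedral_ext (flip Upper) a b PI).
    rewrite dihedral_ext_flip, dihedral_ext_PI by assumption. simpl. ring. }
(* Conjugation carries phi = PI to phi = - PI and exchanges the two Lorentzian angles. *)
assert (EM : forall s, dihedral_ext s a b (- PI) = (pmR s * Ci * psi_L Lower a b)%C).
{ intros s. rewrite dihedral_ext_opp, EP, psi_L_conj by assumption.
  unfold Cconj, Ci, Copp, Cmult, RtoC; simpl. f_equal; ring. }
repeat split; intros; rewrite ?E.
- replace (phi + 4 * PI) with (phi + 2 * PI + 2 * PI) by ring.
  rewrite !dihedral_ext_shift. ring.
- apply dihedral_ext_clog; assumption.
- apply dihedral_ext_clog_outer; assumption.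
- change Lower with (flip Upper). rewrite dihedral_ext_flip. ring.
- rewrite dihedral_ext_opp. reflexivity.
- rewrite dihedral_ext_opp. reflexivity.
- rewrite E0. reflexivity.
- rewrite E2. reflexivity.
- rewrite EP, psi_L_E by assumption. simpl. field.
- rewrite EM, psi_L_E by assumption. simpl. field.
- rewrite EP, psi_L_E by assumption. simpl. field.
- rewrite EM, psi_L_E by assumption. simpl. field.
- apply E0.
- apply E2.
- apply EP.
- apply EM.
Qed.
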